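(* Let $\pi$ be a supersingular representation of $G=\mathrm{GL}_2(F)$. Then $\pi|_P$ is an irreducible representation of $P$.
   Context: $F$ non-Archimedean local field of residual characteristic $p$. $P$ the upper triangular Borel subgroup of $G$, $T$ the diagonal torus. Representations are smooth on $\overline{\mathbf F}_p$-vector spaces. For a smooth character $\chi$ of $T$ viewed as a character of $P$, $\mathrm{Ind}_P^G\chi$ is the smooth induction (locally constant $f:G\to\overline{\mathbf F}_p$ with $f(bg)=\chi(b)f(g)$, $G$ acting by right translation). A supersingular representation is an irreducible smooth representation of $G$ admitting a central character which is not isomorphic to a subquotient of $\mathrm{Ind}_P^G\chi$ for any smooth character $\chi$ of $T$. *)

(* Defs.v *)
From HB Require Import structures.
From mathcomp Require Import all_boot all_order all_algebra.
Set Implicit Arguments. Unset Strict Implicit. Unset Printing Implicit Defensive.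
Import Order.TTheory GRing.Theory Num.Theory.
Local Open Scope ring_scope.

Section LocalField.
Variable F : fieldType.
Variable v : F -> int. (* normalized discrete valuation on F^x; value at 0 irrelevant *)

(* v(x) >= n, with the convention v(0) = +oo *)
Definition vge (x : F) (n : int) : Prop := x = 0 \/ n <= v x.

Definition discrete_valuation : Prop :=
  [/\ forall x y, x != 0 -> y != 0 -> v (x * y) = v x + v y,
      forall x y, x != 0 -> y != 0 -> x + y != 0 ->
                  (v x <= v (x + y)) \/ (v y <= v (x + y))
    & exists x, x != 0 /\ v x = 1].

Definition vcomplete : Prop :=
  forall u : nat -> F,
    (forall N : int, exists M, forall m n, (M <= m)%N -> (M <= n)%N -> vge (u m - u n) N) ->
    exists l, forall N : int, exists M, forall n, (M <= n)%N -> vge (u n - l) N.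

Definition finite_residue_field_char (p : nat) : Prop :=
  [/\ prime p, vge (p%:R) 1 &
      exists s : seq F, (forall y, y \in s -> vge y 0) /\
        forall x, vge x 0 -> exists2 y, y \in s & vge (x - y) 1].

Definition nonarch_local_field (p : nat) : Prop :=
  [/\ discrete_valuation, vcomplete & finite_residue_field_char p].

Definition GL2 (g : 'M[F]_2) : Prop := g \in unitmx.
Definition upper_tri (g : 'M[F]_2) : Prop := g ord_max ord0 = 0.
Definition Borel (g : 'M[F]_2) : Prop := GL2 g /\ upper_tri g.
(* principal congruence subgroup K_n = 1 + varpi^n M_2(O), n >= 1;
   these form a basis of open neighbourhoods of 1 in GL_2(F) *)
Definition congr (n : nat) (g : 'M[F]_2) : Prop :=
  forall i j, vge (g i j - (1%:M : 'M[F]_2) i j) n%:Z.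

Section Reps.
Variable k : fieldType.

Definition smooth_rep (V : lmodType k) (rho : 'M[F]_2 -> V -> V) : Prop :=
  [/\ forall g a (x y : V), GL2 g -> rho g (a *: x + y) = a *: rho g x + rho g y,
      forall x, rho 1%:M x = x,
      forall g h x, GL2 g -> GL2 h -> rho (g *m h) x = rho g (rho h x)
    & forall x, exists n : nat, forall g, congr n.+1 g -> rho g x = x].

Definition subspace (V : lmodType k) (W : V -> Prop) : Prop :=
  W 0 /\ forall a x y, W x -> W y -> W (a *: x + y).

Definition irreducible_on (H : 'M[F]_2 -> Prop) (V : lmodType k)
    (rho : 'M[F]_2 -> V -> V) : Prop :=
  (exists x : V, x != 0) /\
  forall W : V -> Prop, subspace W ->
    (forall g x, H g -> W x -> W (rho g x)) ->
    (forall x, W x -> x = 0) \/ (forall x, W x).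

Definition has_central_character (V : lmodType k) (rho : 'M[F]_2 -> V -> V) : Prop :=
  exists omega : F -> k, forall z (x : V), z != 0 -> rho (z%:M) x = omega z *: x.

(* smooth character of F^x (values at 0 irrelevant) *)
Definition smooth_char (chi : F -> k) : Prop :=
  [/\ forall x y, x != 0 -> y != 0 -> chi (x * y) = chi x * chi y,
      forall x, x != 0 -> chi x != 0
    & exists n : nat, forall x, vge (x - 1) n.+1%:Z -> chi x = 1].

(* Ind_P^G chi, chi = chi1 (x) chi2 a smooth character of T viewed on P;
   functions are taken to vanish off GL_2(F) *)
Definition Ind (chi1 chi2 : F -> k) (f : 'M[F]_2 -> k) : Prop :=
  [/\ forall g, ~ GL2 g -> f g = 0,
      forall b g, Borel b -> GL2 g ->
        f (b *m g) = chi1 (b ord0 ord0) * chi2 (b ord_max ord_max) * f g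
    & forall g, GL2 g -> exists n : nat, forall h, congr n.+1 h -> f (g *m h) = f g].

Definition rtrans (g : 'M[F]_2) (f : 'M[F]_2 -> k) : 'M[F]_2 -> k :=
  fun x => f (x *m g).

(* (V, rho) is isomorphic to a subquotient W2/W1 of Ind_P^G chi:
   equivalently there is a G-stable subspace W2 of Ind and a G-equivariant
   linear surjection W2 ->> V (W1 being its kernel). *)
Definition subquotient_of_Ind (chi1 chi2 : F -> k) (V : lmodType k)
    (rho : 'M[F]_2 -> V -> V) : Prop :=
  exists (W : ('M[F]_2 -> k) -> Prop) (phi : ('M[F]_2 -> k) -> V),
    [/\ (forall f, W f -> Ind chi1 chi2 f),
        W (fun _ => 0),
        (forall a f h, W f -> W h -> W (fun x => a * f x + h x)),
        (forall g f, GL2 g -> W f -> W (rtrans g f)) &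
     [/\ (forall a f h, W f -> W h -> phi (fun x => a * f x + h x) = a *: phi f + phi h),
        (forall g f, GL2 g -> W f -> phi (rtrans g f) = rho g (phi f))
      & (forall x : V, exists2 f, W f & phi f = x)]].

Definition supersingular (V : lmodType k) (rho : 'M[F]_2 -> V -> V) : Prop :=
  [/\ irreducible_on GL2 rho,
      has_central_character rho
    & forall chi1 chi2, smooth_char chi1 -> smooth_char chi2 ->
        ~ subquotient_of_Ind chi1 chi2 rho].

End Reps.
End LocalField.

(* k is (a model of) \overline{F}_p : algebraically closed, characteristic p,
   and algebraic over F_p *)
Definition is_Fpbar (p : nat) (k : closedFieldType) : Prop :=
  p \in [pchar k] /\ forall x : k, exists n, (0 < n)%N /\ x ^+ (p ^ n) = x.

(* Main.v *)
(* Let W be a proper nonzero P-stable subspace of V, let pi be a uniformizer, t = diag(pi, 1),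
   Pi = [0 1; pi 0], and let T be the operator sum_x u(x) t on the vectors fixed by the pro-p
   Iwahori subgroup I1, where u(x) = [1 x; 0 1] and x runs through residue representatives.
   Since I1 is pro-p and k has characteristic p, W contains nonzero I1-fixed vectors. If y is one of
   them then Pi y is not in W, because V is irreducible and GL2 = P I1 + P Pi I1.

   Such a vector w, chosen to be an eigenvector of the integral torus, is algebraic under T.
   Otherwise the translates of the K-representation generated by T w along the spheres of the tree
   are in direct sum as far as I1-invariants are concerned: the I1-fixed vectors of V lie in
   span(T^i w, i > 0) + Pi span(T^i w, i > 0), and w itself is then a combination of the T^i w, i > 0.

   So W contains an eigenvector y of T. Modulo W, diag(1, pi) acts on Pi y like T, and it follows that
   V / W is a line spanned by Pi y, on which P acts by a smooth character chi. Frobenius reciprocity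
   embeds V into Ind chi, contradicting supersingularity. *)
Require Import Defs.
From HB Require Import structures.
From mathcomp Require Import all_boot all_order all_algebra.
From mathcomp Require Import ring zify.
From mathcomp.classical Require Import boolp functions.
Set Implicit Arguments. Unset Strict Implicit. Unset Printing Implicit Defensive.
Import Order.TTheory GRing.Theory Num.Theory.
Local Open Scope ring_scope.

(** * Simultaneous eigenvectors *)

(** No finiteness is assumed on V: its I1-fixed vectors may span an infinite-dimensional space, so a
    relation among the T^i w does not come for free. It is forced by irreducibility, by bounding the
    I1-invariants of the G-span of T w. Starting from T w and not from w has two reasons. If the T^i
    w are independent, the GL2(O)-representation generated by T w has a single line of invariants
    under the u(a), a in O; this makes invariants computable vertex by vertex. And the invariants so
    found involve T^i w with i > 0 only, so that expressing w through them is a genuine relation.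
    All uses of pro-p groups go through one device: filter the group so that each layer acts through
    a finite commuting family of operators with g^p = 1, and take common eigenvectors of that
    family. The device also proves injectivity: a nonzero kernel stable under the group would
    contain a nonzero invariant, so it suffices to exclude invariants from the kernel. *)

Section Subspaces.
Variables (k : fieldType) (X : lmodType k).
Implicit Types (Y Z : X -> Prop) (g : X -> X).

Definition lin g := forall a x y, g (a *: x + y) = a *: g x + g y.

Definition addS Y Z x := exists y z, [/\ Y y, Z z & x = y + z].

Lemma linD g x y : lin g -> g (x + y) = g x + g y.
Proof. by move=> gl; have := gl 1 x y; rewrite !scale1r. Qed.

Lemma lin0 g : lin g -> g 0 = 0.
Proof. by move=> gl; have /eqP := linD 0 0 gl; rewrite addr0 -subr_eq0 opprD addNKr oppr_eq0 => /eqP. Qed.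

Lemma linZ g a x : lin g -> g (a *: x) = a *: g x.
Proof. by move=> gl; have := gl a x 0; rewrite !addr0 (lin0 gl) addr0. Qed.

Lemma linN g x : lin g -> g (- x) = - g x.
Proof. by move=> gl; rewrite -scaleN1r linZ // scaleN1r. Qed.

Lemma linB g x y : lin g -> g (x - y) = g x - g y.
Proof. by move=> gl; rewrite linD // linN. Qed.

Lemma lin_sum g (I : Type) (r : seq I) (P : pred I) (f : I -> X) :
  lin g -> g (\sum_(i <- r | P i) f i) = \sum_(i <- r | P i) g (f i).
Proof.
move=> gl; elim/big_rec2: _ => [|i y x _ <-]; first exact: lin0.
by rewrite linD.
Qed.

Lemma subspace0 Y : subspace Y -> Y 0.
Proof. by case. Qed.

Lemma subspaceZ Y a x : subspace Y -> Y x -> Y (a *: x).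
Proof. by case=> Y0 YD Yx; rewrite -[_ *: _]addr0; apply: YD. Qed.

Lemma subspaceD Y x y : subspace Y -> Y x -> Y y -> Y (x + y).
Proof. by case=> Y0 YD Yx Yy; rewrite -[x]scale1r; apply: YD. Qed.

Lemma subspaceN Y x : subspace Y -> Y x -> Y (- x).
Proof. by move=> sY Yx; rewrite -scaleN1r; apply: subspaceZ. Qed.

Lemma subspaceB Y x y : subspace Y -> Y x -> Y y -> Y (x - y).
Proof. by move=> sY Yx Yy; apply: subspaceD => //; apply: subspaceN. Qed.

Lemma subspace_sum Y (I : eqType) (r : seq I) (f : I -> X) :
  subspace Y -> (forall i, i \in r -> Y (f i)) -> Y (\sum_(i <- r) f i).
Proof.
move=> sY Yf; rewrite big_seq; elim/big_rec: _ => [|i x /Yf ? ?]; first exact: subspace0.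
exact: subspaceD.
Qed.

Lemma subspaceI Y Z : subspace Y -> subspace Z -> subspace (fun x => Y x /\ Z x).
Proof.
by move=> [Y0 YD] [Z0 ZD]; split=> // a x y [? ?] [? ?]; split; auto.
Qed.

Lemma subspaceI_all (I : Type) (P : I -> Prop) (Y : I -> X -> Prop) :
  (forall i, P i -> subspace (Y i)) -> subspace (fun x => forall i, P i -> Y i x).
Proof.
move=> sY; split=> [i /sY[]//|a x y Yx Yy i Pi].
by case: (sY i Pi) => _; apply; auto.
Qed.

Lemma subspace_pre g Y : lin g -> subspace Y -> subspace (fun x => Y (g x)).
Proof. by move=> gl [Y0 YD]; split=> [|a x y *]; rewrite ?lin0 ?gl; auto. Qed.

Lemma subspace_eqlin g h : lin g -> lin h -> subspace (fun x => g x = h x).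
Proof. by move=> gl hl; split=> [|a x y ex ey]; rewrite ?lin0 // gl hl ex ey. Qed.

Lemma subspace_addS Y Z : subspace Y -> subspace Z -> subspace (addS Y Z).
Proof.
move=> [Y0 YD] [Z0 ZD]; split; first by exists 0, 0; rewrite addr0.
move=> a _ _ [y [z [Yy Zz ->]]] [y' [z' [Yy' Zz' ->]]].
exists (a *: y + y'), (a *: z + z'); split; auto.
by rewrite scalerDr addrACA.
Qed.

Lemma lin_id : lin id. Proof. by []. Qed.

Lemma lin_scale a : lin ( *:%R a).
Proof. by move=> b x y; rewrite scalerDr !scalerA mulrC. Qed.

Lemma subspace_line (m : X) : subspace (fun x => exists c, x = c *: m).
Proof.
split; first by exists 0; rewrite scale0r.
by move=> a _ _ [c ->] [d ->]; exists (a * c + d); rewrite scalerDl scalerA.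
Qed.

End Subspaces.

Section Eigenvectors.
Variables (k : closedFieldType) (X : lmodType k).

Let pact (g : X -> X) (f : {poly k}) (x : X) := \sum_(i < size f) f`_i *: iter i g x.

Let pact_widen g (f : {poly k}) x n : (size f <= n)%N ->
  pact g f x = \sum_(i < n) f`_i *: iter i g x.
Proof.
move=> le_n; rewrite /pact (big_ord_widen _ (fun i => f`_i *: iter i g x) le_n) big_mkcond.
apply: eq_bigr => i _; case: ifP => // /negbT; rewrite -leqNgt => le_i.
by rewrite nth_default // scale0r.
Qed.

Let pact_factor g a (h : {poly k}) x : lin g ->
  pact g (h * ('X - a%:P)) x = g (pact g h x) - a *: pact g h x.
Proof.
move=> gl; set f := h * _; have le1 : (size f <= (size h).+1)%N.
  by apply: leq_trans (size_polyMleq _ _) _; rewrite size_XsubC addn2.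
rewrite (pact_widen _ _ le1) {2}(pact_widen _ _ (leqnSn (size h))) lin_sum // scaler_sumr.
transitivity (\sum_(i < (size h).+1) (h * 'X)`_i *: iter i g x
   - \sum_(i < (size h).+1) (a * h`_i) *: iter i g x).
  rewrite -sumrB; apply: eq_bigr => i _.
  by rewrite -scalerBl /f mulrBr coefB coefMC [_ * a]mulrC.
congr (_ - _); last by apply: eq_bigr => i _; rewrite scalerA.
rewrite big_ord_recl coefMX eqxx scale0r add0r.
by apply: eq_bigr => i _; rewrite coefMX /= linZ.
Qed.

(** A polynomial killing x splits over [k]. Peel off a factor X - a with cofactor h: either h(g) x =
    0 and the degree has dropped, or h(g) x is the eigenvector, which lies in [Y] as a combination
    of iterates of [g] at x. *)
Lemma eigen_of_relation (g : X -> X) (Y : X -> Prop) x n (c : nat -> k) :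
    lin g -> subspace Y -> (forall y, Y y -> Y (g y)) -> Y x -> x != 0 ->
    (exists2 i, (i < n)%N & c i != 0) -> \sum_(i < n) c i *: iter i g x = 0 ->
  exists a y, [/\ Y y, y != 0 & g y = a *: y].
Proof.
move=> gl sY gY Yx x0 [i lt_in ci] rel.
pose f := \poly_(i < n) c i.
have f0 : f != 0.
  by apply: contraNneq ci => /(congr1 (fun p : {poly k} => p`_i)); rewrite coef_poly lt_in coef0 => ->.
have {rel} rel : pact g f x = 0.
  rewrite (pact_widen _ _ (size_poly n c)) -[RHS]rel.
  by apply: eq_bigr => j _; rewrite coef_poly ltn_ord.
move: f0 rel; move: f => f {i n c lt_in ci}.
have : (size f <= size f)%N by [].
move: {2}(size f) => m; elim: m f => [|m IH] f + f0 rel.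
  by rewrite leqn0 size_poly_eq0 (negPf f0).
have [/size_poly1P [c c0 ef]|/closed_rootP [a /factor_theorem [h ef]]] := boolP (size f == 1%N).
  move: rel; rewrite (@pact_widen g f x 1) ef ?size_polyC_leq1 // big_ord1 coefC /=.
  by move/eqP; rewrite scaler_eq0 (negPf c0) (negPf x0).
have h0 : h != 0 by apply: contraNneq f0 => h0; rewrite ef h0 mul0r.
rewrite ef pact_factor // in rel.
rewrite ef size_Mmonic ?monicXsubC // size_XsubC addn2 /= ltnS => le_m.
have [hx0|hx0] := eqVneq (pact g h x) 0; first exact: IH hx0.
exists a, (pact g h x); split=> //; last by apply/eqP; rewrite -subr_eq0 rel.
have Yit j : Y (iter j g x) by elim: j => //= j; apply: gY.
by apply: subspace_sum => // j _; apply: subspaceZ.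
Qed.

(** Finite order supplies the annihilating polynomial, and commutation keeps an eigenspace stable
    under the remaining operators. Both are asked on [Y] only, because the operators used later have
    these properties only on vectors of a given level. *)
Lemma simultaneous_eigenvector (T : eqType) (act : T -> X -> X) (s : seq T) (Y : X -> Prop) x :
    subspace Y -> Y x -> x != 0 ->
    (forall g, g \in s -> lin (act g)) ->
    (forall g y, g \in s -> Y y -> Y (act g y)) ->
    (forall g h y, g \in s -> h \in s -> Y y -> act g (act h y) = act h (act g y)) ->
    (forall g, g \in s -> exists2 n, (0 < n)%N & forall y, Y y -> iter n (act g) y = y) ->
  exists y, [/\ Y y, y != 0 & forall g, g \in s -> exists a, act g y = a *: y].
Proof.
elim: s Y x => [|g s IH] Y x sY Yx x0 gl gY gC gn; first by exists x.
have [n n0 gn1] := gn g (mem_head _ _).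
(* These are the coefficients of X^n - 1. *)
have [|||||||a [y [Yy y0 gy]]] := @eigen_of_relation (act g) Y x n.+1
   (fun i => (i == n)%:R - (i == 0)%:R) => //.
- by apply: gl; rewrite mem_head.
- by move=> y; apply: gY; rewrite mem_head.
- by exists n; rewrite // eqxx (gtn_eqF n0) subr0 oner_eq0.
- under eq_bigr do rewrite scalerBl; rewrite sumrB big_ord_recr /= eqxx scale1r gn1 //.
  rewrite big1 => [|i _]; last by rewrite (ltn_eqF (ltn_ord i)) scale0r.
  rewrite add0r big_ord_recl eqxx scale1r big1 ?addr0 ?subrr // => i _.
  by rewrite scale0r.
have sY' : subspace (fun z => Y z /\ act g z = a *: z).
  apply: subspaceI => //; apply: subspace_eqlin; last exact: lin_scale.
  by apply: gl; rewrite mem_head.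
have sub h : h \in s -> h \in g :: s by move=> hs; rewrite inE hs orbT.
have [||||||z [[Yz gz] z0 hz]] := IH _ y sY' => //.
- by move=> h /sub; apply: gl.
- move=> h z hs [Yz gz]; split; first exact: gY (sub _ hs) _.
  rewrite gC ?mem_head ?sub // gz linZ //; exact: gl (sub _ hs).
- by move=> h h' z hs hs' [Yz _]; apply: gC => //; apply: sub.
- by move=> h /sub/gn [m m0 hm]; exists m => // z [Yz _]; apply: hm.
exists z; split=> // h; rewrite inE => /predU1P[->|/hz//].
by exists a.
Qed.

(* In characteristic p an operator with g^p = 1 has 1 as its only eigenvalue. *)
Lemma fixed_vector_step p (T : eqType) (act : T -> X -> X) (L : T -> Prop) (rs : seq T)
    (Y : X -> Prop) x :
    p \in [pchar k] -> subspace Y -> Y x -> x != 0 ->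
    (forall g, L g -> lin (act g)) ->
    (forall g y, L g -> Y y -> Y (act g y)) ->
    (forall g h y, L g -> L h -> Y y -> act g (act h y) = act h (act g y)) ->
    (forall g y, L g -> Y y -> iter p (act g) y = y) ->
    (forall g, L g -> exists r, [/\ r \in rs, L r & forall y, Y y -> act g y = act r y]) ->
  exists y, [/\ Y y, y != 0 & forall g, L g -> act g y = y].
Proof.
move=> pk sY Yx x0 gl gY gC gp rep.
have mem_s g : g \in [seq r <- rs | `[<L r>]] -> L g by rewrite mem_filter => /andP[/asboolP].
have [||||y [Yy y0 yE]] := @simultaneous_eigenvector T act [seq r <- rs | `[<L r>]] Y x sY Yx x0.
- by move=> g /mem_s; apply: gl.
- by move=> g y /mem_s; apply: gY.
- by move=> g h y /mem_s ? /mem_s ?; apply: gC.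
- move=> g /mem_s Lg; exists p; last by move=> y; apply: gp.
  exact: prime_gt0 (pcharf_prime pk).
exists y; split=> // g /rep[r [rrs Lr ->//]].
have [|a ra] := yE r; first by rewrite mem_filter rrs andbT; apply/asboolP.
have it n : iter n (act r) y = a ^+ n *: y.
  elim: n => [|n IH]; first by rewrite scale1r.
  by rewrite iterS IH linZ ?ra ?scalerA -?exprSr //; apply: gl.
have := gp r y Lr Yy; rewrite it -[RHS]scale1r => /eqP.
rewrite -subr_eq0 -scalerBl scaler_eq0 (negPf y0) orbF subr_eq0 => /eqP ap.
have a1 : a = 1.
  by apply: (fmorph_inj (pFrobenius_aut pk)); change (a ^+ p = 1 ^+ p); rewrite expr1n.
by rewrite ra a1 scale1r.
Qed.

End Eigenvectors.

(** * Valuations and residues *)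

Section Matrices.
Variable F : fieldType.

Definition m2 (a b c d : F) : 'M[F]_2 :=
  \matrix_(i, j) if i == ord0 then (if j == ord0 then a else b)
                 else (if j == ord0 then c else d).

Lemma m2_00 a b c d : m2 a b c d ord0 ord0 = a. Proof. by rewrite mxE. Qed.
Lemma m2_01 a b c d : m2 a b c d ord0 ord_max = b. Proof. by rewrite mxE. Qed.
Lemma m2_10 a b c d : m2 a b c d ord_max ord0 = c. Proof. by rewrite mxE. Qed.
Lemma m2_11 a b c d : m2 a b c d ord_max ord_max = d. Proof. by rewrite mxE. Qed.
Definition m2E := (m2_00, m2_01, m2_10, m2_11).

Lemma ord2 (i : 'I_2) : i = ord0 \/ i = ord_max.
Proof. by case: i => [[|[|//]] lt_i]; [left|right]; apply: val_inj. Qed.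

Lemma mx2P (A B : 'M[F]_2) :
  [/\ A ord0 ord0 = B ord0 ord0, A ord0 ord_max = B ord0 ord_max,
      A ord_max ord0 = B ord_max ord0 & A ord_max ord_max = B ord_max ord_max] -> A = B.
Proof. by case=> *; apply/matrixP => i j; case: (ord2 i) => ->; case: (ord2 j) => ->. Qed.

Lemma m2_eta (g : 'M[F]_2) : g = m2 (g ord0 ord0) (g ord0 ord_max) (g ord_max ord0) (g ord_max ord_max).
Proof. by apply: mx2P; rewrite !m2E. Qed.

Lemma m2P (P : 'M[F]_2 -> Prop) : (forall a b c d, P (m2 a b c d)) -> forall g, P g.
Proof. by move=> Pm g; rewrite (m2_eta g). Qed.

Lemma mulm2 a b c d a' b' c' d' :
  m2 a b c d *m m2 a' b' c' d'
  = m2 (a * a' + b * c') (a * b' + b * d') (c * a' + d * c') (c * b' + d * d').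
Proof.
by apply: mx2P; split; rewrite !m2E mxE !big_ord_recl big_ord0 addr0 -?ord_max_lift ?lift0 //;
  rewrite (_ : lift ord0 ord0 = ord_max) ?m2E //; apply: val_inj.
Qed.

Lemma scalar_m2 z : z%:M = m2 z 0 0 z.
Proof. by apply: mx2P; rewrite !m2E !mxE. Qed.

Lemma GL2_m2 a b c d : GL2 (m2 a b c d) <-> a * d - b * c != 0.
Proof.
rewrite /GL2 unitmxE unitfE (_ : \det _ = a * d - b * c) //.
rewrite (expand_det_row _ ord0) !big_ord_recl big_ord0 /cofactor !det_mx11 !mxE /=.
ring.
Qed.

End Matrices.

Ltac m2eq := rewrite ?mulm2; congr (m2 _ _ _ _).

Section Valuation.
Variables (F : fieldType) (v : F -> int).
Hypothesis (hv : discrete_valuation v).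

Let vM x y : x != 0 -> y != 0 -> v (x * y) = v x + v y.
Proof. by case: hv => vM _ _; apply: vM. Qed.

Let v1 : v 1 = 0.
Proof. by apply: (addrI (v 1)); rewrite addr0 -vM ?oner_eq0 // mulr1. Qed.

Let vN x : v (- x) = v x.
Proof.
have [->|x0] := eqVneq x 0; first by rewrite oppr0.
have N1 : (-1 : F) != 0 by rewrite oppr_eq0 oner_eq0.
rewrite -mulN1r vM //; have := vM N1 N1; rewrite mulrNN mulr1 v1; lia.
Qed.

Lemma valn_inv x : x != 0 -> v x^-1 = - v x.
Proof. by move=> x0; have := vM x0 (invr_neq0 x0); rewrite divff // v1; lia. Qed.

Lemma valn_mul x y : x != 0 -> y != 0 -> v (x * y) = v x + v y.
Proof. exact: vM. Qed.

Lemma valn_one : v 1 = 0. Proof. exact: v1. Qed.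

Lemma vge0 n : vge v 0 n. Proof. by left. Qed.

Lemma vgeW m n x : m <= n -> vge v x n -> vge v x m.
Proof. by move=> le_mn [->|le_n]; [left|right; apply: le_trans le_n]. Qed.

Lemma vgeD n x y : vge v x n -> vge v y n -> vge v (x + y) n.
Proof.
move=> [->|le_x]; first by rewrite add0r.
move=> [->|le_y]; first by rewrite addr0; right.
have [->|xy0] := eqVneq (x + y) 0; first by left.
have [x0|x0] := eqVneq x 0; first by rewrite x0 add0r; right.
have [y0|y0] := eqVneq y 0; first by rewrite y0 addr0; right.
by case: hv => _ vD _; case: (vD x y x0 y0 xy0) => h; right; apply: le_trans h.
Qed.

Lemma vgeN n x : vge v x n -> vge v (- x) n.
Proof. by move=> [->|le_x]; [rewrite oppr0; left|right; rewrite vN]. Qed.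

Lemma vgeB n x y : vge v x n -> vge v y n -> vge v (x - y) n.
Proof. by move=> ? ?; apply: vgeD => //; apply: vgeN. Qed.

Lemma vgeBC n x y : vge v (x - y) n -> vge v (y - x) n.
Proof. by move=> /vgeN; rewrite opprB. Qed.

Lemma vgeB_trans n x y z : vge v (x - y) n -> vge v (y - z) n -> vge v (x - z) n.
Proof. by move=> h1 h2; have := vgeD h1 h2; rewrite addrA subrK. Qed.

Lemma vgeMD m n x y : vge v x m -> vge v y n -> vge v (x * y) (m + n).
Proof.
move=> [->|le_x]; first by rewrite mul0r; left.
move=> [->|le_y]; first by rewrite mulr0; left.
have [->|x0] := eqVneq x 0; first by rewrite mul0r; left.
have [->|y0] := eqVneq y 0; first by rewrite mulr0; left.
by right; rewrite vM //; lia.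
Qed.

Lemma vgeMl n x y : vge v x n -> vge v y 0 -> vge v (x * y) n.
Proof. by rewrite -{2}[n]addr0; apply: vgeMD. Qed.

Lemma vgeMr n x y : vge v x 0 -> vge v y n -> vge v (x * y) n.
Proof. by rewrite -{2}[n]add0r; apply: vgeMD. Qed.

Lemma vge01 x : vge v x 1 -> vge v x 0. Proof. exact: vgeW. Qed.

Lemma vge1 : vge v 1 0. Proof. by right; rewrite v1. Qed.

Definition vunit x := x != 0 /\ v x = 0.

Lemma vunit1 : vunit 1. Proof. by split; rewrite ?oner_eq0 ?v1. Qed.

Lemma vunitM x y : vunit x -> vunit y -> vunit (x * y).
Proof. by move=> [x0 ?] [y0 ?]; split; rewrite ?mulf_neq0 ?vM //; lia. Qed.

Lemma vunitV x : vunit x -> vunit x^-1.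
Proof. by move=> [x0 vx]; split; rewrite ?invr_eq0 ?valn_inv ?vx. Qed.

Lemma vunitN x : vunit x -> vunit (- x).
Proof. by move=> [x0 vx]; split; rewrite ?oppr_eq0 ?vN. Qed.

Lemma vunitX x n : vunit x -> vunit (x ^+ n).
Proof. by move=> ux; elim: n => [|n IH]; [exact: vunit1|rewrite exprS; apply: vunitM]. Qed.

Lemma vunit_neq0 x : vunit x -> x != 0. Proof. by case. Qed.

Lemma vunit_vge0 x : vunit x -> vge v x 0. Proof. by case=> _ vx; right; rewrite vx. Qed.

Lemma vunit_not_vge1 x : vunit x -> ~ vge v x 1.
Proof. by move=> [x0 vx] [/eqP|]; [rewrite (negPf x0)|rewrite vx]. Qed.

Lemma vunitP x : vge v x 0 -> vunit x \/ vge v x 1.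
Proof.
move=> Ox; have [->|x0] := eqVneq x 0; first by right; left.
case: Ox => [/eqP|le0]; first by rewrite (negPf x0).
by have [vx|vx] := eqVneq (v x) 0; [left|right; right; lia].
Qed.

Lemma vunitD x y : vunit x -> vge v y 1 -> vunit (x + y).
Proof.
move=> ux py; case: (@vunitP (x + y)) => [|//|pxy].
  by apply: vgeD; [apply: vunit_vge0|apply: vge01].
by case: (vunit_not_vge1 ux); have := vgeB pxy py; rewrite addrK.
Qed.

Lemma vunitDr x y : vunit x -> vge v y 1 -> vunit (y + x).
Proof. by rewrite addrC; apply: vunitD. Qed.

Lemma vunitB x y : vunit x -> vge v y 1 -> vunit (x - y).
Proof. by move=> ? /vgeN; apply: vunitD. Qed.

Lemma vunit_near x y : vunit y -> vge v (x - y) 1 -> vunit x.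
Proof. by move=> uy pxy; rewrite -(subrK y x); apply: vunitDr. Qed.

Lemma vge0_near x y : vge v y 0 -> vge v (x - y) 1 -> vge v x 0.
Proof. by move=> uy pxy; rewrite -(subrK y x); apply: vgeD => //; apply: vge01. Qed.

Lemma near1_vunit x : vge v (x - 1) 1 -> vunit x.
Proof. exact: vunit_near vunit1. Qed.

Lemma vgeV_near n x y : vunit x -> vunit y -> vge v (x - y) n -> vge v (x^-1 - y^-1) n.
Proof.
move=> ux uy h; have x0 := vunit_neq0 ux; have y0 := vunit_neq0 uy.
have -> : x^-1 - y^-1 = - (x - y) * (x^-1 * y^-1) by field; rewrite x0 y0.
apply: vgeMl; first exact: vgeN.
by apply: vunit_vge0; apply: vunitM; apply: vunitV.
Qed.

End Valuation.

Create HintDb val.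
#[export] Hint Resolve vge0 vge1 vgeD vgeN vunit_vge0 vge01 vunit1 vunitM vunitV vunitN : val.
#[export] Hint Resolve vgeMl | 5 : val.
#[export] Hint Resolve vgeMr | 5 : val.

Section Residues.
Variables (F : fieldType) (v : F -> int) (R : seq F).
Hypothesis (hv : discrete_valuation v).

Definition residue_system :=
  [/\ uniq R, forall y, y \in R -> vge v y 0,
      forall x y, x \in R -> y \in R -> vge v (x - y) 1 -> x = y
    & forall x, vge v x 0 -> exists2 y, y \in R & vge v (x - y) 1].
Hypothesis (hR : residue_system).

(** The condition on [x] sits under the quantifier so that choice yields a total function [rep],
    arbitrary outside the valuation ring. *)
Lemma rep_exists x : exists y, vge v x 0 -> y \in R /\ vge v (x - y) 1.
Proof.
case: hR => _ _ _ rep.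
by have [/rep[y]|?] := pselect (vge v x 0); [exists y|exists 0].
Qed.

Definition rep x := projT1 (cid (rep_exists x)).

Lemma rep_in x : vge v x 0 -> rep x \in R.
Proof. by rewrite /rep; case: cid => y h /h[]. Qed.

Lemma rep_near x : vge v x 0 -> vge v (x - rep x) 1.
Proof. by rewrite /rep; case: cid => y h /h[]. Qed.

Lemma R_vge0 x : x \in R -> vge v x 0.
Proof. by case: hR => _ RO _ _; apply: RO. Qed.

Lemma R_near_eq x y : x \in R -> y \in R -> vge v (x - y) 1 -> x = y.
Proof. by case: hR => _ _ Rinj _; apply: Rinj. Qed.

Lemma rep_eq x y : vge v x 0 -> y \in R -> vge v (x - y) 1 -> rep x = y.
Proof.
move=> Ox yR xy; apply: R_near_eq (rep_in Ox) yR _.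
by apply: (vgeB_trans hv) xy; apply: (vgeBC hv); apply: rep_near.
Qed.

Lemma rep_id x : x \in R -> rep x = x.
Proof. by move=> xR; apply: rep_eq; rewrite ?subrr; [apply: R_vge0|by []|left]. Qed.

Lemma rep_periodic x y : vge v x 0 -> vge v (x - y) 1 -> rep x = rep y.
Proof.
move=> Ox xy; have Oy : vge v y 0 by apply: (vge0_near hv Ox); apply: (vgeBC hv).
by apply: rep_eq (rep_in Oy) _ => //; apply: (vgeB_trans hv) xy (rep_near Oy).
Qed.

(** [h] need not map [R] to itself: followed by [rep] it is injective on the finite set [R], hence a
    permutation of it, and [f] depends only on the residue. *)
Lemma sum_reindex (Z : zmodType) (f phi : F -> Z) (h : F -> F) :
    (forall x, vge v x 0 -> vge v (h x) 0) ->
    (forall x y, vge v x 0 -> vge v y 0 -> vge v (h x - h y) 1 -> vge v (x - y) 1) ->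
    (forall x y, vge v x 0 -> vge v (x - y) 1 -> f x = f y) ->
    (forall x, x \in R -> phi x = f (h x)) ->
  \sum_(x <- R) phi x = \sum_(x <- R) f x.
Proof.
move=> hO hinj fper fE; rewrite (eq_big_seq _ fE) => {fE}.
have u_s : uniq [seq rep (h x) | x <- R].
  rewrite map_inj_in_uniq; first by case: hR.
  move=> x y xR yR e; apply: R_near_eq => //; have [Ox Oy] := (R_vge0 xR, R_vge0 yR).
  apply: hinj => //; apply: (vgeB_trans hv) (rep_near (hO _ Ox)) _.
  by rewrite e; apply: (vgeBC hv); apply: rep_near; apply: hO.
have sub : {subset [seq rep (h x) | x <- R] <= R}.
  by move=> _ /mapP[x xR ->]; apply: rep_in; apply: hO; apply: R_vge0.
have [|_ e] := uniq_min_size u_s sub; first by rewrite size_map.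
transitivity (\sum_(x <- [seq rep (h x) | x <- R]) f x); last first.
  by apply: perm_big; apply: uniq_perm => //; case: hR.
rewrite big_map; apply: eq_big_seq => x xR.
have Oh : vge v (h x) 0 by apply: hO; apply: R_vge0.
by apply: fper => //; apply: rep_near.
Qed.

(** Pigeonhole on the residues of the powers of [a]. *)
Lemma vunit_torsion a : vunit v a -> exists2 n, (0 < n)%N & vge v (a ^+ n - 1) 1.
Proof.
move=> ua; pose s := [seq rep (a ^+ i) | i <- iota 0 (size R).+1].
have Oa n : vge v (a ^+ n) 0 by apply: vunit_vge0; apply: (vunitX hv).
have /(uniqPn 0)[i [j [lt_ij]]] : ~~ uniq s.
  apply/negP => us; have : (size s <= size R)%N.
    by apply: uniq_leq_size => // _ /mapP[n _ ->]; apply: rep_in.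
  by rewrite size_map size_iota ltnn.
rewrite size_map size_iota => lt_j.
rewrite !(nth_map 0%N) ?size_iota ?(ltn_trans lt_ij) // !nth_iota ?(ltn_trans lt_ij) // !add0n => e.
exists (j - i)%N; first by rewrite subn_gt0.
have /(vgeMr hv (vunit_vge0 (vunitV hv (vunitX hv i ua)))) : vge v (a ^+ j - a ^+ i) 1.
  apply: (vgeB_trans hv) (rep_near (Oa j)) _.
  by rewrite -e; apply: (vgeBC hv); apply: rep_near.
have ai0 := vunit_neq0 (vunitX hv i ua).
rewrite mulrBr mulVf //; suff -> : (a ^+ i)^-1 * a ^+ j = a ^+ (j - i) by [].
by rewrite -{1}(subnK (ltnW lt_ij)) exprD mulrCA mulVf ?mulr1.
Qed.

End Residues.

Lemma residue_system_exists (F : fieldType) (v : F -> int) (s : seq F) :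
    discrete_valuation v -> (forall y, y \in s -> vge v y 0) ->
    (forall x, vge v x 0 -> exists2 y, y \in s & vge v (x - y) 1) ->
  exists R, residue_system v R.
Proof.
move=> hv sO srep.
suff [R [uR RO Rinj Rrep]] : exists R : seq F, [/\ uniq R, forall y, y \in R -> vge v y 0,
    forall x y, x \in R -> y \in R -> vge v (x - y) 1 -> x = y
    & forall x, x \in s -> exists2 y, y \in R & vge v (x - y) 1].
  exists R; split=> // x /srep[y ys xy]; have [z zR yz] := Rrep y ys.
  by exists z => //; apply: (vgeB_trans hv) xy yz.
elim: s sO {srep} => [|a s IH] sO; first by exists [::].
have [|R [uR RO Rinj Rrep]] := IH; first by move=> y ys; apply: sO; rewrite inE ys orbT.
have [[b bR ab]|nb] := pselect (exists2 b, b \in R & vge v (a - b) 1).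
  exists R; split=> // x; rewrite inE => /predU1P[->|/Rrep//].
  by exists b.
exists (a :: R); split.
- rewrite /= uR andbT; apply/negP => aR; case: nb; exists a => //.
  by rewrite subrr; left.
- move=> y; rewrite inE => /predU1P[->|/RO//].
  by apply: sO; rewrite mem_head.
- move=> x y; rewrite !inE => /predU1P[->|xR] /predU1P[->|yR] // xy.
  + by case: nb; exists y.
  + by case: nb; exists x => //; apply: (vgeBC hv).
  + exact: Rinj.
- move=> x; rewrite inE => /predU1P[->|/Rrep[y yR xy]].
    by exists a; rewrite ?mem_head // subrr; left.
  by exists y => //; rewrite inE yR orbT.
Qed.

(** * Fixed vectors of pro-p subgroups *)

Section Integral.
Variables (F : fieldType) (v : F -> int) (pi : F) (R : seq F).
Hypothesis (hv : discrete_valuation v) (pi0 : pi != 0) (vpi : v pi = 1)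
  (hR : residue_system v R).

Definition um (x : F) := m2 1 x 0 1.
Definition dm (a d : F) := m2 a 0 0 d.
Definition sm : 'M[F]_2 := m2 0 1 1 0.
Definition Pim := m2 0 1 pi 0.

Definition KO (g : 'M[F]_2) :=
  (forall i j, vge v (g i j) 0) /\
  vunit v (g ord0 ord0 * g ord_max ord_max - g ord0 ord_max * g ord_max ord0).

Definition mcong n (A B : 'M[F]_2) := forall i j, vge v (A i j - B i j) n.

(* [Lv 1 0] is the pro-p Iwahori subgroup, [Lv n n] the congruence subgroup of level n. *)
Definition Lv (m j : nat) (g : 'M[F]_2) :=
  [/\ vge v (g ord0 ord0 - 1) m%:Z, vge v (g ord0 ord_max) j%:Z,
      vge v (g ord_max ord0) m%:Z & vge v (g ord_max ord_max - 1) m%:Z].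

Definition I1 := Lv 1 0.

Lemma KO_m2 a b c d :
  KO (m2 a b c d) <-> [/\ vge v a 0, vge v b 0, vge v c 0, vge v d 0 & vunit v (a * d - b * c)].
Proof.
rewrite /KO !m2E; split=> [[O u]|[Oa Ob Oc Od u]].
  by split=> //; [move: (O ord0 ord0)|move: (O ord0 ord_max)|move: (O ord_max ord0)|
    move: (O ord_max ord_max)]; rewrite m2E.
by split=> // i j; case: (ord2 i) => ->; case: (ord2 j) => ->; rewrite m2E.
Qed.

Lemma mcong_m2 n a b c d a' b' c' d' :
  mcong n (m2 a b c d) (m2 a' b' c' d') <->
  [/\ vge v (a - a') n, vge v (b - b') n, vge v (c - c') n & vge v (d - d') n].
Proof.
split=> [O|[Oa Ob Oc Od] i j].
  by split=> //; [move: (O ord0 ord0)|move: (O ord0 ord_max)|move: (O ord_max ord0)|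
    move: (O ord_max ord_max)]; rewrite !m2E.
by case: (ord2 i) => ->; case: (ord2 j) => ->; rewrite !m2E.
Qed.

Lemma congr_mcong n g : congr v n g <-> mcong n g 1%:M.
Proof. by []. Qed.

Lemma Lv_m2 m j a b c d : Lv m j (m2 a b c d) <->
  [/\ vge v (a - 1) m%:Z, vge v b j%:Z, vge v c m%:Z & vge v (d - 1) m%:Z].
Proof. by rewrite /Lv !m2E. Qed.

Lemma congr_Lv n g : congr v n g <-> Lv n n g.
Proof.
by elim/m2P: g => a b c d; rewrite congr_mcong scalar_m2 mcong_m2 Lv_m2 !subr0.
Qed.

Lemma KO_GL2 g : KO g -> GL2 g.
Proof. by elim/m2P: g => a b c d /KO_m2[_ _ _ _ /vunit_neq0]; rewrite GL2_m2. Qed.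

Lemma KOM g h : KO g -> KO h -> KO (g *m h).
Proof.
elim/m2P: g => a b c d; elim/m2P: h => a' b' c' d'.
rewrite mulm2 !KO_m2 => -[? ? ? ? u] [? ? ? ? u']; split; auto with val.
have -> : (a * a' + b * c') * (c * b' + d * d') - (a * b' + b * d') * (c * a' + d * c')
  = (a * d - b * c) * (a' * d' - b' * c') by ring.
exact: vunitM.
Qed.

Lemma Lv_KO m j g : (0 < m)%N -> Lv m j g -> KO g.
Proof.
move=> m0; elim/m2P: g => a b c d /Lv_m2[ha hb hc hd].
have w x : vge v x m%:Z -> vge v x 1 by apply: vgeW; rewrite lez_nat.
have ua := near1_vunit hv (w _ ha); have ud := near1_vunit hv (w _ hd).
have Ob : vge v b 0 by apply: vgeW hb; rewrite lez_nat.
apply/KO_m2; split; auto with val.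
by apply: (vunitB hv); auto with val.
Qed.

Lemma KO1 : KO 1%:M.
Proof.
by rewrite scalar_m2; apply/KO_m2; rewrite mulr1 mulr0 subr0; split; auto with val.
Qed.

Lemma vgeX n : vge v (pi ^+ n) n%:Z.
Proof.
elim: n => [|n IH]; first exact: vge1.
rewrite exprSr -addn1 PoszD; apply: vgeMD => //.
by right; rewrite vpi.
Qed.

Lemma vgeXV n x : vge v x n%:Z -> vge v (x / pi ^+ n) 0.
Proof.
have n0 : pi ^+ n != 0 by rewrite expf_neq0.
have vn : v (pi ^+ n) = n%:Z.
  elim: n {n0} => [|n IH]; first by rewrite expr0 valn_one.
  by rewrite exprS valn_mul ?expf_neq0 // IH vpi; lia.
move=> [->|le_n]; first by rewrite mul0r; left.
have [->|x0] := eqVneq x 0; first by rewrite mul0r; left.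
by right; rewrite valn_mul ?invr_neq0 // valn_inv // vn; lia.
Qed.

Section Rep.
Variables (p : nat) (k : closedFieldType) (V : lmodType k) (rho : 'M[F]_2 -> V -> V).
Hypothesis (pres : vge v (p%:R) 1) (pk : p \in [pchar k]) (hrho : smooth_rep v rho).

Lemma rho_lin g : GL2 g -> lin (rho g).
Proof. by case: hrho => gl _ _ _ Gg a x y; apply: gl. Qed.

Lemma rho1 x : rho 1%:M x = x.
Proof. by case: hrho. Qed.

Lemma rhoM g h x : GL2 g -> GL2 h -> rho (g *m h) x = rho g (rho h x).
Proof. by case: hrho => _ _ gM _; apply: gM. Qed.

Lemma rho_smooth x : exists n : nat, forall g, congr v n.+1 g -> rho g x = x.
Proof. by case: hrho. Qed.

(** [B] has an integral inverse, so B^-1 A lies in the congruence subgroup of level n. This turns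
    identities between operators on vectors of a given level into congruences between matrix
    entries. *)
Lemma rho_mcong n A B x : KO A -> KO B -> mcong n%:Z A B ->
  (forall g, congr v n g -> rho g x = x) -> rho A x = rho B x.
Proof.
elim/m2P: A => a b c d; elim/m2P: B => a' b' c' d' KA KB /mcong_m2[? ? ? ?] fx.
have /KO_m2[? ? ? ? u] := KB; have u0 := vunit_neq0 u; have uV := vunit_vge0 (vunitV hv u).
set D := _ - _ in u u0 uV.
(* The inverse of [B] by the adjugate formula. *)
pose C := m2 (d' / D) (- b' / D) (- c' / D) (a' / D).
have e : m2 a b c d = m2 a' b' c' d' *m (C *m m2 a b c d).
  by rewrite !mulm2; congr m2; rewrite /D; field.
have cC : congr v n (C *m m2 a b c d).
  rewrite /C mulm2 congr_mcong scalar_m2 mcong_m2; split.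
  - have -> : d' / D * a + - b' / D * c - 1 = ((a - a') * d' - b' * (c - c')) * D^-1.
      by rewrite /D; field.
    by auto 7 with val.
  - have -> : d' / D * b + - b' / D * d - 0 = ((b - b') * d' - b' * (d - d')) * D^-1.
      by rewrite /D; field.
    by auto 7 with val.
  - have -> : - c' / D * a + a' / D * c - 0 = (a' * (c - c') - (a - a') * c') * D^-1.
      by rewrite /D; field.
    by auto 7 with val.
  - have -> : - c' / D * b + a' / D * d - 1 = (a' * (d - d') - (b - b') * c') * D^-1.
      by rewrite /D; field.
    by auto 7 with val.
have GC : GL2 (C *m m2 a b c d).
  rewrite /GL2 unitmx_mul; apply/andP; split; last exact: (KO_GL2 KA).
  apply/GL2_m2; have -> : d' / D * (a' / D) - - b' / D * (- c' / D) = D^-1 by rewrite /D; field.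
  by rewrite invr_eq0.
by rewrite e rhoM ?(fx _ cC) //; apply: KO_GL2.
Qed.

(** Modulo the congruence subgroup of level j + 1 the group [Lv m j] is abelian of exponent p: for g
    = 1 + X and h = 1 + Y the difference gh - hg = XY - YX has order at least j + 1, and p lies in
    the maximal ideal. The condition on [m] and [j] admits both kinds of layers that are needed:
    level n + 1 over level n + 2 (m = j), and I1 over level 1 (m = 1, j = 0). *)
Lemma fixed_vector_descent m j (Y : V -> Prop) x : (0 < m)%N -> (j <= m <= j.+1)%N ->
    subspace Y -> (forall g y, Lv m j g -> Y y -> Y (rho g y)) ->
    Y x -> x != 0 -> (forall g, congr v j.+1 g -> rho g x = x) ->
  exists y, [/\ Y y, y != 0 & forall g, Lv m j g -> rho g y = y].
Proof.
move=> m0 /andP[le_jm le_mj] sY gY Yx x0 fx.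
have W' e y : vge v y e%:Z -> vge v y 0 by apply: vgeW; lia.
have M1 y z : vge v y m%:Z -> vge v z j%:Z -> vge v (y * z) j.+1%:Z.
  by move=> hy hz; apply: vgeW (vgeMD hv hy hz); lia.
have M2 y z : vge v y j%:Z -> vge v z m%:Z -> vge v (y * z) j.+1%:Z.
  by move=> hy hz; rewrite mulrC; apply: M1.
have mj y : vge v y m%:Z -> vge v y j%:Z by apply: vgeW; lia.
have GL g : Lv m j g -> GL2 g by move=> /(Lv_KO m0)/KO_GL2.
(* Representatives of that quotient: one residue for the leading coefficient of each entry of g -
   1. *)
pose rs := [seq m2 (1 + pi ^+ m * q.1.1.1) (pi ^+ j * q.1.1.2) (pi ^+ m * q.1.2) (1 + pi ^+ m * q.2)
  | q <- allpairs pair (allpairs pair (allpairs pair R R) R) R].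
have [||||||||y [[Yy fy] y0 yE]] := @fixed_vector_step k V p _ rho (Lv m j) rs
   (fun y => Y y /\ forall g, congr v j.+1 g -> rho g y = y) x pk.
- apply: subspaceI => //; apply: subspaceI_all => g cg.
  apply: subspace_eqlin; last exact: lin_id.
  by apply: rho_lin; apply: KO_GL2; apply: Lv_KO (ltn0Sn j) _; apply/congr_Lv.
- by [].
- by [].
- by move=> g /GL/rho_lin.
- move=> g y Lg [Yy fy]; split; first exact: gY.
  move=> h ch; have Kh : KO h by apply: Lv_KO (ltn0Sn j) _; apply/congr_Lv.
  have Kg := Lv_KO m0 Lg.
  rewrite -rhoM; [|exact: KO_GL2 ..].
  apply: rho_mcong fy => //; first exact: KOM.
  move: ch Kg; elim/m2P: g {Lg} => a b c d; elim/m2P: h {Kh} => a' b' c' d'.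
  rewrite congr_mcong scalar_m2 mcong_m2 !subr0 => -[? ? ? ?] /KO_m2[? ? ? ? _].
  rewrite mulm2 mcong_m2; split.
  + by rewrite (_ : _ - _ = (a' - 1) * a + b' * c); [auto with val|ring].
  + by rewrite (_ : _ - _ = (a' - 1) * b + b' * d); [auto with val|ring].
  + by rewrite (_ : _ - _ = c' * a + (d' - 1) * c); [auto with val|ring].
  + by rewrite (_ : _ - _ = c' * b + (d' - 1) * d); [auto with val|ring].
- move=> g h y Lg Lh [Yy fy]; rewrite -!rhoM; try exact: GL.
  have [Kg Kh] := (Lv_KO m0 Lg, Lv_KO m0 Lh).
  apply: rho_mcong fy; [exact: KOM|exact: KOM|].
  move: Lg Lh {Kg Kh}; elim/m2P: g => a b c d; elim/m2P: h => a' b' c' d'.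
  rewrite !Lv_m2 !mulm2 mcong_m2 => -[? ? ? ?] [? ? ? ?]; split.
  + by rewrite (_ : _ - _ = b * c' - b' * c); [auto with val|ring].
  + rewrite (_ : _ - _ = (a - 1) * b' - b' * (d - 1) + b * (d' - 1) - (a' - 1) * b); last ring.
    by auto 7 with val.
  + rewrite (_ : _ - _ = c * (a' - 1) - (a - 1) * c' + (d - 1) * c' - c * (d' - 1)); last ring.
    by auto 7 with val.
  + by rewrite (_ : _ - _ = c * b' - c' * b); [auto with val|ring].
- move=> g y Lg [Yy fy].
  have Kg := Lv_KO m0 Lg.
  have Kp n : KO (iter n (mulmx g) 1%:M) by elim: n => [|n IH]; [exact: KO1|exact: KOM].
  have itE n : iter n (rho g) y = rho (iter n (mulmx g) 1%:M) y.
    elim: n => [|n IH]; first by rewrite rho1.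
    by rewrite !iterS IH rhoM //; apply: KO_GL2.
  rewrite itE.
  rewrite -[RHS]rho1; apply: rho_mcong fy => //; first exact: KO1.
  move: Lg; rewrite (m2_eta g); move: (g _ _) (g _ _) (g _ _) (g _ _) => d c b a.
  rewrite Lv_m2 => -[ha hb hc hd].
  have On n : vge v n%:R 0 by elim: n => [|n IH]; [exact: vge0|rewrite -addn1 natrD; auto with val].
  (* Up to level j + 1 the power g^n is 1 + n (g - 1); at n = p the second term is absorbed. *)
  have pow n : exists a' b' c' d', iter n (mulmx (m2 a b c d)) 1%:M = m2 a' b' c' d' /\
     mcong j.+1%:Z (m2 a' b' c' d')
       (m2 (1 + n%:R * (a - 1)) (n%:R * b) (n%:R * c) (1 + n%:R * (d - 1))).
    elim: n => [|n [a' [b' [c' [d' [IH /mcong_m2[ea eb ec ed]]]]]]].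
      exists 1, 0, 0, 1; rewrite scalar_m2; split=> //; apply/mcong_m2.
      by rewrite !mul0r !addr0 !subrr; split; auto with val.
    have L (e : nat) w x' y' : (e <= j.+1)%N -> vge v (x' - (y' + n%:R * w)) j.+1%:Z ->
        vge v w e%:Z -> vge v (x' - y') e%:Z.
      move=> le_e h1 h2; rewrite (_ : x' - y' = x' - (y' + n%:R * w) + n%:R * w); last ring.
      by apply: (vgeD hv); [apply: vgeW h1; lia|auto with val].
    have a'm := L _ _ _ _ le_mj ea ha; have d'm := L _ _ _ _ le_mj ed hd.
    have b'j : vge v b' j%:Z by have := L j b b' 0 (leqnSn j); rewrite add0r subr0; apply.
    have c'm : vge v c' m%:Z by have := L m c c' 0 le_mj; rewrite add0r subr0; apply.
    rewrite iterS IH mulm2.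
    exists (a * a' + b * c'), (a * b' + b * d'), (c * a' + d * c'), (c * b' + d * d').
    split=> //; apply/mcong_m2; rewrite -addn1 natrD; split.
    + rewrite (_ : _ - _ = (a' - (1 + n%:R * (a - 1))) + (a - 1) * (a' - 1) + b * c'); last ring.
      by auto 6 with val.
    + rewrite (_ : _ - _ = (b' - n%:R * b) + (a - 1) * b' + b * (d' - 1)); last ring.
      by auto 6 with val.
    + rewrite (_ : _ - _ = (c' - n%:R * c) + c * (a' - 1) + (d - 1) * c'); last ring.
      by auto 6 with val.
    + rewrite (_ : _ - _ = (d' - (1 + n%:R * (d - 1))) + (d - 1) * (d' - 1) + c * b'); last ring.
      by auto 6 with val.
  have [a' [b' [c' [d' [-> /mcong_m2[ea eb ec ed]]]]]] := pow p.
  rewrite scalar_m2 mcong_m2.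
  have P w x' y' : vge v (x' - (y' + p%:R * w)) j.+1%:Z -> vge v w j%:Z -> vge v (x' - y') j.+1%:Z.
    move=> h1 h2; rewrite (_ : x' - y' = x' - (y' + p%:R * w) + p%:R * w); last ring.
    by apply: (vgeD hv) => //; apply: vgeW (vgeMD hv pres h2); lia.
  split.
  + by apply: P ea _; apply: mj.
  + by apply: (P b); rewrite ?add0r.
  + by apply: (P c); rewrite ?add0r //; apply: mj.
  + by apply: P ed _; apply: mj.
- move=> g Lg; have Kg := Lv_KO m0 Lg.
  move: Lg Kg; rewrite (m2_eta g); move: (g _ _) (g _ _) (g _ _) (g _ _) => d c b a.
  move=> /Lv_m2[ha hb hc hd] Kg.
  pose r e z := rep hR (z / pi ^+ e).
  have rO e z : vge v z e%:Z -> vge v (r e z) 0 by move/vgeXV => h; apply: (R_vge0 hR); apply: rep_in.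
  have rE e z : vge v z e%:Z -> vge v (z - pi ^+ e * r e z) e.+1%:Z.
    move=> hz; have e0 : pi ^+ e != 0 by rewrite expf_neq0.
    rewrite (_ : _ - _ = pi ^+ e * (z / pi ^+ e - r e z)); last by field.
    by rewrite -addn1 PoszD; apply: (vgeMD hv); [apply: vgeX|apply: rep_near; apply: vgeXV].
  pose g' := m2 (1 + pi ^+ m * r m (a - 1)) (pi ^+ j * r j b) (pi ^+ m * r m c)
    (1 + pi ^+ m * r m (d - 1)).
  have Lg' : Lv m j g'.
    apply/Lv_m2; split; rewrite ?(addrC 1) ?addrK; apply: (vgeMl hv) => //; (exact: vgeX || exact: rO).
  exists g'; split=> //.
    apply/mapP; exists (r m (a - 1), r j b, r m c, r m (d - 1)) => //.
    by apply: (allpairs_f pair); [apply: (allpairs_f pair); [apply: (allpairs_f pair)|]|];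
      apply: rep_in; apply: vgeXV.
  move=> z [_ fz]; apply: rho_mcong fz => //; first exact: Lv_KO Lg'.
  apply/mcong_m2; split; last 3 first.
  + exact: rE.
  + by apply: vgeW (rE _ _ hc); lia.
  + by rewrite opprD addrA; apply: vgeW (rE _ _ hd); lia.
  + by rewrite opprD addrA; apply: vgeW (rE _ _ ha); lia.
by exists y.
Qed.

(** By smoothness x is fixed by some congruence subgroup; each descent lowers the level by one, and
    the last one passes from level 1 to I1. *)
Lemma I1_fixed_vector (Y : V -> Prop) x :
    subspace Y -> (forall g y, I1 g -> Y y -> Y (rho g y)) -> Y x -> x != 0 ->
  exists y, [/\ Y y, y != 0 & forall g, I1 g -> rho g y = y].
Proof.
move=> sY gY Yx x0; have [n fx] := rho_smooth x.
elim: n x Yx x0 fx => [|n IH] x Yx x0 fx.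
  by apply: (@fixed_vector_descent 1 0 Y x).
have gYn g y : Lv n.+1 n.+1 g -> Y y -> Y (rho g y).
  by move=> [? ? ? ?]; apply: gY; split; (apply: vgeW; last by eauto); lia.
have [||y [Yy y0 fy]] := @fixed_vector_descent n.+1 n.+1 Y x _ _ sY gYn Yx x0 fx => //.
  by rewrite leqnn leqnSn.
by apply: (IH y) => // g /congr_Lv; apply: fy.
Qed.

End Rep.
End Integral.

(** * Translates under the unipotent group *)

Section Unipotent.
Variables (F : fieldType) (v : F -> int) (pi : F) (R : seq F).
Hypothesis (hv : discrete_valuation v) (pi0 : pi != 0) (vpi : v pi = 1)
  (hR : residue_system v R).
Variables (p : nat) (k : closedFieldType) (V : lmodType k) (rho : 'M[F]_2 -> V -> V).
Hypothesis (pres : vge v (p%:R) 1) (pk : p \in [pchar k]) (hrho : smooth_rep v rho).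

Notation u x := (rho (um x)).

Lemma um_GL (x : F) : GL2 (um x).
Proof. by apply/GL2_m2; rewrite mulr1 mulr0 subr0 oner_eq0. Qed.

Lemma um_lin x : lin (u x).
Proof. exact: rho_lin hrho _ (um_GL x). Qed.

Lemma um0 y : u 0 y = y.
Proof. by rewrite /um -scalar_m2 (rho1 hrho). Qed.

Lemma umD a b y : u a (u b y) = u (a + b) y.
Proof.
rewrite -(rhoM hrho); [|exact: um_GL..].
by congr (rho _ y); rewrite /um mulm2; congr m2; ring.
Qed.

Lemma um_sum (f : F -> V) x : u x (\sum_(r <- R) f r) = \sum_(r <- R) u x (f r).
Proof. exact: lin_sum (um_lin x). Qed.

Lemma um_congr n a : vge v a n%:Z -> congr v n (um a).
Proof.
move=> ha; apply/congr_Lv/Lv_m2; rewrite subrr.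
by split=> //; left.
Qed.

Lemma um_smooth (s : seq V) : exists n : nat, forall y a, y \in s -> vge v a n.+1%:Z -> u a y = y.
Proof.
elim: s => [|y s [n IH]]; first by exists 0%N.
have [m fy] := rho_smooth hrho y.
exists (maxn m n) => z a; rewrite inE => /predU1P[->|zs] ha.
  by apply: fy; apply: um_congr; apply: vgeW ha; lia.
by apply: IH => //; apply: vgeW ha; lia.
Qed.

Variables (X : V -> Prop) (m : V).
Hypothesis (sX : subspace X) (uX : forall a y, vge v a 1 -> X y -> X (u a y))
  (Xm : forall y, X y -> (forall a, vge v a 1 -> u a y = y) -> exists c, y = c *: m)
  (m0 : \sum_(x <- R) u x m != 0).

(** Write N(O) and N(pi) for the groups of the u(a) with a integral, respectively in the maximal
    ideal. This is the action of N(O) on the representation induced from the N(pi)-module [X],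
    realised by functions z with z(x) in u(x) X. They live on F because translations do not preserve
    [R]. *)
Let act a (z : F -> V) : F -> V := fun x => u a (z (x - a)).

(** The kernel of the summation map from the induced representation to V. *)
Let Y (z : F -> V) :=
  [/\ forall x a, vge v x 0 -> vge v a 1 -> z (x + a) = z x,
      forall x, vge v x 0 -> X (u (- x) (z x)),
      forall x, ~ vge v x 0 -> z x = 0
    & \sum_(x <- R) z x = 0].

Let actD a b z : act a (act b z) = act (a + b) z.
Proof. by apply/funext => x; rewrite /act umD opprD addrA. Qed.

Let act_lin a : lin (act a).
Proof. by move=> c y z; apply/funext => x; rewrite /act -[RHS]um_lin. Qed.

Let sY : subspace Y.
Proof.
split; first by split=> // [x _|]; rewrite ?(lin0 (um_lin _)) ?big1 //; apply: subspace0.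
move=> a y z [y1 y2 y3 y4] [z1 z2 z3 z4].
have E x : (a *: y + z) x = a *: y x + z x by [].
split=> [x b Ox pb|x Ox|x nOx|].
- by rewrite !E y1 ?z1.
- by rewrite E um_lin; case: sX => _; apply; auto.
- by rewrite E y3 ?z3 // scaler0 addr0.
- by under eq_bigr do rewrite E; rewrite big_split /= -scaler_sumr y4 z4 scaler0 addr0.
Qed.

Let actY a z : vge v a 0 -> Y z -> Y (act a z).
Proof.
move=> Oa [z1 z2 z3 z4]; split=> [x b Ox pb|x Ox|x nOx|].
- rewrite /act addrAC (z1 (x - a) b) //; exact: (vgeB hv).
- by rewrite /act umD addrC -opprB; apply: z2; apply: (vgeB hv).
- rewrite /act z3 ?(lin0 (um_lin _)) // => Oxa; apply: nOx.
  by rewrite -(subrK a x); apply: (vgeD hv).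
- rewrite /act -um_sum (_ : \sum_(r <- R) _ = 0) ?(lin0 (um_lin _)) // -[RHS]z4.
  apply: (sum_reindex hv hR (h := fun x => x - a)) => //.
  + by move=> x Ox; apply: (vgeB hv).
  + by move=> x y _ _; rewrite opprB addrA subrK.
  + by move=> x y Ox xy; rewrite -[y](subrK x) addrC z1 //; apply: (vgeBC hv).
Qed.

(** An invariant function is determined by its value at 0, which is fixed by N(pi) and hence equals
    c [m]; the sum of its values is then c times a nonzero vector. *)
Let Y_fixed0 z : Y z -> (forall a, vge v a 0 -> act a z = z) -> z = 0.
Proof.
move=> [z1 z2 z3 z4] fz.
have zE x : vge v x 0 -> z x = u x (z 0).
  by move=> /fz/(congr1 (fun f => f x)); rewrite /act subrr.
have [||c ec] := Xm (y := z 0).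
- by have := z2 0 (vge0 _ _); rewrite oppr0 um0.
- by move=> a pa; have := zE a (vge01 pa); rewrite -{1}[a]add0r (z1 0 a (vge0 _ _) pa).
have c0 : c = 0.
  apply/eqP; move/eqP: z4; rewrite (eq_big_seq (fun x => c *: u x m)) => [|x /(R_vge0 hR)/zE->].
    by rewrite -scaler_sumr scaler_eq0 (negPf m0) orbF.
  by rewrite ec (linZ _ _ (um_lin x)).
apply/funext => x; have [Ox|] := pselect (vge v x 0); last exact: z3.
by rewrite zE // ec c0 scale0r (lin0 (um_lin x)).
Qed.

(** Descent along the layers pi^n O / pi^(n+1) O, with [fixed_vector_step] applied to the space of
    functions. *)
Let Y0 n z : Y z -> (forall a, vge v a n%:Z -> act a z = z) -> z = 0.
Proof.
elim: n z => [|n IH] z Yz fz; first exact: Y_fixed0.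
apply/eqP/negPn/negP => z0.
have w a : vge v a n%:Z -> vge v a 0 by apply: vgeW.
have [||||||||y [[Yy fy] y0 yE]] := @fixed_vector_step k (F -> V) p _ act (fun a => vge v a n%:Z)
  [seq pi ^+ n * r | r <- R] (fun z => Y z /\ forall a, vge v a n.+1%:Z -> act a z = z) z pk.
- apply: subspaceI => //; apply: subspaceI_all => a _.
  by apply: subspace_eqlin => //; apply: lin_id.
- by [].
- by [].
- by move=> a _; apply: act_lin.
- move=> a y ha [Yy fy]; split; first by apply: actY => //; apply: w.
  by move=> b hb; rewrite actD addrC -actD fy.
- by move=> a b y _ _ _; rewrite !actD addrC.
- move=> a y ha [Yy fy].
  have itE i : iter i (act a) y = act (i%:R * a) y.
    elim: i => [|i IHi]; first by apply/funext => x; rewrite /act mul0r um0 subr0.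
    by rewrite iterS IHi actD -addn1 natrD mulrDl mul1r addrC.
  by rewrite itE; apply: fy; rewrite -addn1 PoszD addrC; apply: (vgeMD hv).
- move=> a ha; have n0 : pi ^+ n != 0 by rewrite expf_neq0.
  have Oq := vgeXV hv pi0 vpi ha.
  exists (pi ^+ n * rep hR (a / pi ^+ n)); split.
  + by apply: map_f; apply: rep_in.
  + by apply: (vgeMl hv); [apply: vgeX|apply: (R_vge0 hR); apply: rep_in].
  + move=> y [_ fy]; rewrite -{2}(fy (a - pi ^+ n * rep hR (a / pi ^+ n))).
      by rewrite actD addrC subrK.
    rewrite (_ : _ - _ = pi ^+ n * (a / pi ^+ n - rep hR (a / pi ^+ n))); last by field.
    by rewrite -addn1 PoszD; apply: (vgeMD hv); [apply: vgeX|apply: rep_near].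
by case/eqP: y0; apply: IH.
Qed.

(** A relation extends periodically to a function in the kernel [Y]. It takes finitely many values,
    so it is fixed by the translations from some pi^n O, and [Y0] applies. *)
Lemma translates_free (y : F -> V) :
    (forall x, x \in R -> X (y x)) -> \sum_(x <- R) u x (y x) = 0 ->
  forall x, x \in R -> y x = 0.
Proof.
move=> Xy sum0.
pose z x := if `[< vge v x 0 >] then u (rep hR x) (y (rep hR x)) else 0.
have zO x : vge v x 0 -> z x = u (rep hR x) (y (rep hR x)) by move=> /asboolP; rewrite /z => ->.
have zN x : ~ vge v x 0 -> z x = 0 by move=> /asboolPn/negPf; rewrite /z => ->.
have zR x : x \in R -> z x = u x (y x) by move=> xR; rewrite zO ?rep_id //; apply: (R_vge0 hR).
have Yz : Y z.
  split=> // [x a Ox pa|x Ox|].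
  - have Oxa : vge v (x + a) 0 by apply: (vgeD hv) => //; apply: vge01.
    by rewrite !zO // (rep_periodic hv hR (x := x + a) (y := x)) // addrAC subrr add0r.
  - rewrite zO // umD addrC; apply: uX; last by apply: Xy; apply: rep_in.
    by apply: (vgeBC hv); apply: rep_near.
  - by rewrite -[RHS]sum0; apply: eq_big_seq.
have [n fz] := um_smooth [seq z x | x <- R].
have z0 : z = 0.
  have [z1 _ _ _] := Yz.
  apply: (Y0 (n := n.+1)) Yz _ => a ha; apply/funext => x; rewrite /act.
  have pa : vge v a 1 by apply: vgeW ha; lia.
  have [Ox|nOx] := pselect (vge v x 0).
    rewrite z1 //; last exact: vgeN.
    have -> : z x = z (rep hR x).
      by rewrite -[rep hR x](subrK x) addrC z1 //; apply: (vgeBC hv); apply: rep_near.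
    by apply: fz => //; apply: map_f; apply: rep_in.
  rewrite !zN ?(lin0 (um_lin a)) // => Oxa; apply: nOx.
  by rewrite -(subrK a x); apply: (vgeD hv) => //; apply: vge01.
move=> x xR; have := zR x xR; rewrite z0 => /(congr1 (u (- x))).
by rewrite umD addNr um0 (lin0 (um_lin _)).
Qed.

(** By freeness u(a) permutes the summands of an invariant sum, so the summand at the residue 0
    determines all the others and is itself fixed by N(pi). *)
Lemma translates_fixed (y : F -> V) :
    (forall x, x \in R -> X (y x)) ->
    (forall a, vge v a 0 -> u a (\sum_(x <- R) u x (y x)) = \sum_(x <- R) u x (y x)) ->
  exists c, forall x, x \in R -> y x = c *: m.
Proof.
move=> Xy fix_sum.
pose r a x := rep hR (x - a).
have O x a : x \in R -> vge v a 0 -> vge v (x - a) 0 by move=> /(R_vge0 hR) ? ?; apply: (vgeB hv).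
(* Compare the summands at x on both sides of the invariance under u(a); [r a x] is the residue that
   translation by a carries to that of x. *)
have tr a x : vge v a 0 -> x \in R -> y x = u (r a x + a - x) (y (r a x)).
  move=> Oa xR; apply/eqP; rewrite -subr_eq0; apply/eqP; move: x xR.
  apply: (translates_free (y := fun x => y x - u (r a x + a - x) (y (r a x)))) => [x xR|].
    have Oxa := O _ _ xR Oa.
    apply: subspaceB => //; first exact: Xy.
    apply: uX; last by apply: Xy; apply: rep_in.
    by rewrite -addrA -opprB; apply: (vgeBC hv); apply: rep_near.
  under eq_bigr do rewrite (linB _ _ (um_lin _)) umD addrCA subrr addr0.
  apply/eqP; rewrite sumrB subr_eq0 -[X in X == _](fix_sum a Oa) um_sum; apply/eqP.
  under eq_bigr do rewrite umD addrC.
  rewrite (sum_reindex hv hR (h := fun x => x - a)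
     (f := fun x => u (rep hR x + a) (y (rep hR x)))) //.
  - by apply: eq_big_seq => x xR; rewrite rep_id.
  - by move=> x Ox; apply: (vgeB hv).
  - by move=> x x' _ _; rewrite opprB addrA subrK.
  - by move=> x x' Ox xx'; rewrite (rep_periodic hv hR Ox xx').
have O0 : vge v 0 0 by left.
have x0R := rep_in hR O0; move: (rep hR 0) x0R => x0 x0R.
have [||c ec] := Xm (y := y x0); first exact: Xy.
  move=> b pb; have Ob := vge01 pb.
  have rx0 : r b x0 = x0.
    apply: (rep_eq hv) => //; first exact: O.
    by rewrite addrAC subrr add0r; apply: vgeN.
  by have := tr b x0 Ob x0R; rewrite rx0 addrAC subrr add0r.
exists c => x xR; have Oxx0 : vge v (x - x0) 0 by apply: O => //; apply: (R_vge0 hR).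
have rx : r (x - x0) x = x0 by rewrite /r opprB addrCA subrr addr0 rep_id.
by rewrite -ec (tr (x - x0) x Oxx0 xR) rx (addrC x0) subrK subrr um0.
Qed.

End Unipotent.

(** * Stable subspaces of an irreducible representation *)

Section Main.
Variables (F : fieldType) (v : F -> int) (pi : F) (R : seq F).
Hypothesis (hv : discrete_valuation v) (pi0 : pi != 0) (vpi : v pi = 1)
  (hR : residue_system v R).
Variables (p : nat) (k : closedFieldType) (V : lmodType k) (rho : 'M[F]_2 -> V -> V).
Hypothesis (pres : vge v (p%:R) 1) (pk : p \in [pchar k]) (hrho : smooth_rep v rho).
Variable (omega : F -> k).
Hypothesis (hZ : forall z (x : V), z != 0 -> rho (z%:M) x = omega z *: x).
Hypothesis (hirr : forall W : V -> Prop, subspace W ->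
  (forall g x, GL2 g -> W x -> W (rho g x)) -> (forall x, W x -> x = 0) \/ (forall x, W x)).

Notation u x := (rho (um x)).
Notation t := (rho (dm pi 1)).
Notation s := (rho (@sm F)).
Notation P := (rho (Pim pi)).
Notation O x := (vge v x 0).

Definition fixI1 y := forall g, I1 v g -> rho g y = y.

Definition hecke y := \sum_(x <- R) u x (t y).

Lemma rhoE A B C x : GL2 B -> GL2 C -> A = B *m C -> rho A x = rho B (rho C x).
Proof. by move=> GB GC ->; apply: rhoM hrho _ _ _ GB GC. Qed.

Lemma GLM (A B : 'M[F]_2) : GL2 A -> GL2 B -> GL2 (A *m B).
Proof. by move=> GA GB; rewrite /GL2 unitmx_mul; apply/andP. Qed.

Lemma rho3 A B C x : GL2 A -> GL2 B -> GL2 C ->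
  rho A (rho B (rho C x)) = rho (A *m (B *m C)) x.
Proof. by move=> GA GB GC; rewrite !(rhoM hrho) //; apply: GLM. Qed.

Lemma rho4 A B C D x : GL2 A -> GL2 B -> GL2 C -> GL2 D ->
  rho A (rho B (rho C (rho D x))) = rho (A *m (B *m (C *m D))) x.
Proof. by move=> GA GB GC GD; rewrite !(rhoM hrho) //; do ?apply: GLM. Qed.

Lemma dm_GL (a d : F) : a != 0 -> d != 0 -> GL2 (dm a d).
Proof. by move=> a0 d0; apply/GL2_m2; rewrite mulr0 subr0 mulf_neq0. Qed.

Lemma t_GL : GL2 (dm pi 1). Proof. exact: dm_GL (oner_neq0 _). Qed.

Lemma s_GL : GL2 (@sm F).
Proof. by apply/GL2_m2; rewrite mulr0 sub0r mulr1 oppr_eq0 oner_eq0. Qed.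

Lemma P_GL : GL2 (Pim pi).
Proof. by apply/GL2_m2; rewrite mulr0 sub0r mul1r oppr_eq0. Qed.

Lemma upper_GL (a b d : F) : a != 0 -> d != 0 -> GL2 (m2 a b 0 d).
Proof. by move=> a0 d0; apply/GL2_m2; rewrite mulr0 subr0 mulf_neq0. Qed.

Lemma lower_GL (c : F) : GL2 (m2 1 0 c 1).
Proof. by apply/GL2_m2; rewrite mulr1 mul0r subr0 oner_eq0. Qed.

Hint Resolve t_GL s_GL P_GL um_GL lower_GL : core.

Let rl g : GL2 g -> lin (rho g). Proof. exact: rho_lin hrho g. Qed.

Lemma rho_inj g x y : GL2 g -> rho g x = rho g y -> x = y.
Proof.
move=> Gg e; have GV : GL2 (invmx g) by rewrite /GL2 unitmx_inv.
have K z : rho (invmx g) (rho g z) = z by rewrite -(rhoM hrho) // mulVmx // (rho1 hrho).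
by rewrite -[x]K e K.
Qed.

Lemma rho_neq0 g x : GL2 g -> x != 0 -> rho g x != 0.
Proof.
move=> Gg; apply: contra_neq => e; apply: (rho_inj Gg).
by rewrite e (lin0 (rl Gg)).
Qed.

(** The vectors whose whole orbit lies in [Y] form a G-stable subspace, nonzero because it contains
    y. *)
Lemma irr_cover (Y : V -> Prop) y : subspace Y -> y != 0 ->
  (forall g, GL2 g -> Y (rho g y)) -> forall x, Y x.
Proof.
move=> sY y0 Yy.
have [||Z0|ZT] := hirr (W := fun x => forall g, GL2 g -> Y (rho g x)).
- apply: subspaceI_all => g Gg; apply: subspace_pre => //; exact: rl.
- move=> g x Gg Zx h Gh; rewrite -(rhoM hrho) //.
  by apply: Zx; rewrite /GL2 unitmx_mul; apply/andP.
- by case/eqP: y0; apply: Z0.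
- move=> x; rewrite -(rho1 hrho x); apply: ZT.
  by rewrite /GL2 unitmx1.
Qed.

Lemma val_dichotomy (c d : F) : (c != 0) || (d != 0) ->
  (d != 0 /\ vge v (c / d) 1) \/ (c != 0 /\ vge v (d / c) 0).
Proof.
have [->|c0] /= := eqVneq c 0; first by move=> d0; left; split; rewrite ?mul0r //; left.
have [->|d0] /= := eqVneq d 0; first by move=> _; right; split; rewrite ?mul0r //; left.
move=> _; rewrite /vge !(valn_mul hv) ?invr_neq0 // !(valn_inv hv) //.
have [h|h] := leP 1 (v c - v d); first by left; split=> //; right.
by right; split=> //; right; lia.
Qed.

Lemma GL2_row (a b c d : F) : GL2 (m2 a b c d) -> (c != 0) || (d != 0).
Proof.
move/GL2_m2; have [->|//] := eqVneq c 0; have [->|//] := eqVneq d 0.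
by rewrite !mulr0 subrr eqxx.
Qed.

(** G = B I1 + B Pi I1, decided by which entry of the lower row dominates. The factor from I1 can be
    taken unipotent, lower in the first cell and upper in the second. *)
Lemma Borel_I1_decomp g : GL2 g ->
  (exists a b c d, [/\ a != 0, d != 0, vge v c 1 & g = m2 a b 0 d *m m2 1 0 c 1]) \/
  (exists a b d e, [/\ a != 0, d != 0, O e & g = m2 a b 0 d *m (Pim pi *m um e)]).
Proof.
elim/m2P: g => a b c d Gg; have det0 : a * d - b * c != 0 by apply/GL2_m2.
case: (val_dichotomy (GL2_row Gg)) => [[d0 cd]|[c0 dc]]; [left|right].
  exists (a - b * c / d), b, (c / d), d; split=> //.
    have -> : a - b * c / d = (a * d - b * c) / d by field.
    by rewrite mulf_neq0 ?invr_neq0.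
  by m2eq; field.
exists (b - a * d / c), (a / pi), (c / pi), (d / c); split=> //; rewrite ?mulf_neq0 ?invr_neq0 //.
  have -> : b - a * d / c = - (a * d - b * c) / c by field.
  by rewrite mulf_neq0 ?invr_neq0 ?oppr_eq0.
by rewrite /Pim /um; m2eq; field; rewrite ?pi0 ?c0.
Qed.

Lemma I1_m2 a b c d : I1 v (m2 a b c d) <->
  [/\ vge v (a - 1) 1, vge v b 0, vge v c 1 & vge v (d - 1) 1].
Proof. exact: Lv_m2. Qed.

Lemma um_I1 a : O a -> I1 v (um a).
Proof. by move=> Oa; apply/I1_m2; rewrite subrr; split=> //; left. Qed.

Lemma lower_I1 c : vge v c 1 -> I1 v (m2 1 0 c 1).
Proof. by move=> pc; apply/I1_m2; rewrite subrr; split=> //; left. Qed.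

Lemma I1_GL g : I1 v g -> GL2 g.
Proof. by move=> h; apply: KO_GL2; exact: (Lv_KO hv _ h). Qed.

Lemma fix_um y a : fixI1 y -> O a -> u a y = y.
Proof. by move=> fy /um_I1/fy. Qed.

Lemma subspace_fixI1 : subspace fixI1.
Proof.
apply: subspaceI_all => g /I1_GL/rl gl; apply: subspace_eqlin => //; exact: lin_id.
Qed.

Lemma hecke_lin : lin hecke.
Proof.
move=> a x y; rewrite /hecke scaler_sumr -big_split /=; apply: eq_bigr => r _.
by rewrite rl // rl.
Qed.

Lemma ut_shift x a y : u (x + a) (t y) = u x (t (u (a / pi) y)).
Proof.
rewrite -(umD hrho) ; congr (u x _).
rewrite -!(rhoM hrho) //; congr (rho _ y).
by rewrite /um /dm; m2eq; field.
Qed.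

Lemma divpi_O a : vge v a 1 -> O (a / pi).
Proof. by move=> h; have := vgeXV hv pi0 vpi (n := 1) h; rewrite expr1. Qed.

Lemma pi_vge : vge v pi 1. Proof. by right; rewrite vpi. Qed.

Lemma ut_periodic x x' y : fixI1 y -> vge v (x - x') 1 -> u x (t y) = u x' (t y).
Proof.
move=> fy h; have -> : x = x' + (x - x') by ring.
by rewrite ut_shift (fix_um fy) //; apply: divpi_O.
Qed.

(** I1 permutes the residue discs: y is the Moebius image (a x + b) / (c x + d), which is x + b
    modulo [pi]. The factor h = t^-1 u(-x') g u(x) t has an integral upper right entry because x' is
    close to y. *)
Lemma I1_ut g x : I1 v g -> O x -> exists2 y, O y &
  vge v (y - (x + g ord0 ord_max)) 1 /\
  forall x', vge v (y - x') 1 -> exists2 h, I1 v h &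
     forall z, rho g (u x (t z)) = u x' (t (rho h z)).
Proof.
elim/m2P: g => a b c d Ig Ox; have /I1_m2[ha hb hc hd] := Ig; rewrite m2E.
have Oa := vunit_vge0 (near1_vunit hv ha); have Od := vunit_vge0 (near1_vunit hv hd).
have uD : vunit v (c * x + d).
  by apply: (vunitDr hv); [exact: (near1_vunit hv hd)|apply: (vgeMl hv)].
have D0 := vunit_neq0 uD; have ODV := vunit_vge0 (vunitV hv uD).
exists ((a * x + b) / (c * x + d)); first by auto with val.
split.
  have -> : (a * x + b) / (c * x + d) - (x + b)
    = ((a - 1) * x - (x + b) * (c * x + (d - 1))) / (c * x + d) by field.
  by auto 8 with val.
move=> x' hx'.
have Ox' : O x'.
  by apply: (vge0_near hv _ (vgeBC hv hx')); auto with val.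
pose B := a * x + b - x' * (c * x + d).
have pB : vge v B 1.
  have -> : B = ((a * x + b) / (c * x + d) - x') * (c * x + d) by rewrite /B; field.
  by auto with val.
pose h := m2 (a - x' * c) (B / pi) (c * pi) (c * x + d).
have Ih : I1 v h.
  apply/I1_m2; split.
  - by rewrite addrAC; auto with val.
  - exact: divpi_O.
  - by apply: (vgeMl hv) => //; apply: vge01 pi_vge.
  - by rewrite -addrA; auto with val.
exists h => // z; rewrite !rho3 //; [|exact: I1_GL..].
by congr (rho _ z); rewrite /h /um /dm /B; m2eq; field.
Qed.

(** The Moebius action permutes the residues, so g permutes the terms of the sum. *)
Lemma hecke_fixI1 y : fixI1 y -> fixI1 (hecke y).
Proof.
move=> fy g Ig; rewrite {1}/hecke (lin_sum _ _ _ (rl (I1_GL Ig))).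
have [h hP] : {h : F -> F & forall x, O x -> [/\ O (h x), vge v (h x - (x + g ord0 ord_max)) 1
    & rho g (u x (t y)) = u (h x) (t y)]}.
  apply: (@choice F F (fun x z => O x -> [/\ O z, vge v (z - (x + g ord0 ord_max)) 1
    & rho g (u x (t y)) = u z (t y)])) => x; have [Ox|nOx] := pselect (O x); last by exists 0.
  have [x' Ox' [near ut]] := I1_ut Ig Ox; exists x' => _; split=> //.
  have [|h Ih ->] := ut x'; first by rewrite subrr; left.
  by rewrite fy.
apply: (sum_reindex hv hR (h := h)) => [x /hP[]//|x x' /hP[_ hx _] /hP[_ hx' _] hxx'| |].
- have -> : x - x' = (h x - h x') - (h x - (x + g ord0 ord_max)) + (h x' - (x' + g ord0 ord_max)).
    by ring.
  by auto with val.
- by move=> x x' _ xx'; apply: ut_periodic.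
- by move=> x /(R_vge0 hR)/hP[].
Qed.

Lemma dm_um a d x y : a != 0 -> d != 0 -> rho (dm a d) (u x y) = u (a * x / d) (rho (dm a d) y).
Proof.
move=> a0 d0; have Gad := dm_GL a0 d0; rewrite -!(rhoM hrho) //; congr (rho _ y).
by rewrite /dm /um; m2eq; field.
Qed.

Lemma dm_t a d y : a != 0 -> d != 0 -> rho (dm a d) (t y) = t (rho (dm a d) y).
Proof.
move=> a0 d0; have Gad := dm_GL a0 d0; rewrite -!(rhoM hrho) //; congr (rho _ y).
by rewrite /dm; m2eq; ring.
Qed.

Lemma dm_P a d y : a != 0 -> d != 0 -> rho (dm a d) (P y) = P (rho (dm d a) y).
Proof.
move=> a0 d0; have Gad := dm_GL a0 d0; have Gda := dm_GL d0 a0.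
rewrite -!(rhoM hrho) //; congr (rho _ y).
by rewrite /dm /Pim; m2eq; ring.
Qed.

Lemma dm_fixI1 a d y : vunit v a -> vunit v d -> fixI1 y -> fixI1 (rho (dm a d) y).
Proof.
move=> ua ud fy; have [a0 d0] := (vunit_neq0 ua, vunit_neq0 ud); have Gad := dm_GL a0 d0.
elim/m2P=> x b c z Ig; have /I1_m2[hx hb hc hz] := Ig.
have Ih : I1 v (m2 x (b * d / a) (c * a / d) z) by apply/I1_m2; split; auto 6 with val.
rewrite -[in RHS](fy _ Ih) -!(rhoM hrho) //; try exact: I1_GL.
by congr (rho _ y); rewrite /dm; m2eq; field; rewrite ?a0 ?d0.
Qed.

Lemma P_normalizes_I1 g : I1 v g -> exists h,
  [/\ I1 v h, forall z, rho g (P z) = P (rho h z) & forall z, P (rho g z) = rho h (P z)].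
Proof.
elim/m2P: g => a b c d Ig; have /I1_m2[ha hb hc hd] := Ig.
have Ih : I1 v (m2 d (c / pi) (b * pi) a).
  by apply/I1_m2; split=> //; [exact: divpi_O|apply: (vgeMr hv) pi_vge].
have [Gg Gh] := (I1_GL Ig, I1_GL Ih).
exists (m2 d (c / pi) (b * pi) a); split=> // z; rewrite -!(rhoM hrho) //;
  by congr (rho _ z); rewrite /Pim; m2eq; field.
Qed.

Lemma P_fixI1 y : fixI1 y -> fixI1 (P y).
Proof. by move=> fy g /P_normalizes_I1[h [Ih -> _]]; rewrite fy. Qed.

Definition torus_eigen (psi : F -> F -> k) y :=
  fixI1 y /\ forall a d, vunit v a -> vunit v d -> rho (dm a d) y = psi a d *: y.

Lemma subspace_torus_eigen psi : subspace (torus_eigen psi).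
Proof.
apply: subspaceI; first exact: subspace_fixI1.
split=> [a d ua ud|b x y hx hy a d ua ud].
  by rewrite scaler0 (lin0 (rl _)) //; apply: dm_GL; apply: vunit_neq0; eauto.
rewrite rl; last by apply: dm_GL; [apply: vunit_neq0 ua|apply: vunit_neq0 ud].
by rewrite hx // hy // scalerDr !scalerA mulrC.
Qed.

Lemma hecke_torus_eigen psi y : torus_eigen psi y -> torus_eigen psi (hecke y).
Proof.
move=> [fy Ey]; split; first exact: hecke_fixI1.
move=> a d ua ud; have [a0 d0] := (vunit_neq0 ua, vunit_neq0 ud); have Gad := dm_GL a0 d0.
rewrite /hecke (lin_sum _ _ _ (rl Gad)) scaler_sumr.
apply: (sum_reindex hv hR (h := fun x => a * x / d) (f := fun x => psi a d *: u x (t y))).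
- by move=> x Ox; auto 6 with val.
- move=> x x' _ _ h; have -> : x - x' = (a * x / d - a * x' / d) * (d / a) by field; rewrite a0 d0.
  by auto with val.
- by move=> x x' _ xx'; rewrite (ut_periodic fy xx').
- by move=> x _; rewrite dm_um // dm_t // Ey // !linZ //; [apply: um_lin hrho _|apply: rl].
Qed.

(** On I1-fixed vectors the integral torus acts through the residues of its entries, so the
    commuting operators in [T], finitely many and of finite order there, generate its action. *)
Lemma exists_torus_eigen (W : V -> Prop) x : subspace W -> W x -> x != 0 -> fixI1 x ->
    (forall a d y, a != 0 -> d != 0 -> W y -> W (rho (dm a d) y)) ->
  exists psi y, [/\ W y, y != 0 & torus_eigen psi y].
Proof.
move=> sW Wx x0 fx WT.
pose U := [seq r <- R | `[< vunit v r >]].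
have UE r : r \in U -> vunit v r by rewrite mem_filter => /andP[/asboolP].
pose T := [seq dm r 1 | r <- U] ++ [seq dm 1 r | r <- U].
have u1 : vunit v 1 by apply: vunit1.
have TE g : g \in T -> exists r r', [/\ vunit v r, vunit v r' & g = dm r r'].
  by rewrite mem_cat => /orP[] /mapP[r /UE ur ->]; [exists r, 1|exists 1, r].
have dmGL a d : vunit v a -> vunit v d -> GL2 (dm a d).
  by move=> /vunit_neq0 ? /vunit_neq0 ?; apply: dm_GL.
have TGL g : g \in T -> GL2 g by move=> /TE[r [r' [ur ur' ->]]]; apply: dmGL.
have dmM a d a' d' : dm a d *m dm a' d' = dm (a * a') (d * d').
  by rewrite /dm; m2eq; ring.
have dm_iter a d n y : vunit v a -> vunit v d -> iter n (rho (dm a d)) y = rho (dm (a ^+ n) (d ^+ n)) y.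
  move=> ua ud; elim: n => [|n IH]; first by rewrite /dm -scalar_m2 (rho1 hrho).
  by rewrite iterS IH -(rhoM hrho) ?dmM -?exprS //; apply: dmGL => //; apply: vunitX.
have dm_I1 a d : vge v (a - 1) 1 -> vge v (d - 1) 1 -> I1 v (dm a d).
  by move=> ha hd; apply/I1_m2; split=> //; left.
have [|||||||y [[Wy fy] y0 yE]] := @simultaneous_eigenvector k V _ rho T (fun y => W y /\ fixI1 y) x.
- by apply: subspaceI => //; apply: subspace_fixI1.
- by [].
- by [].
- by move=> g /TGL/rl.
- move=> _ y /TE[r [r' [ur ur' ->]]] [Wy fy]; split; last exact: dm_fixI1.
  by apply: WT => //; apply: vunit_neq0; eauto.
- move=> _ _ y /TE[a [d [ua ud ->]]] /TE[a' [d' [ua' ud' ->]]] _.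
  have [G1 G2] := (dmGL _ _ ua ud, dmGL _ _ ua' ud').
  by rewrite -!(rhoM hrho) // !dmM mulrC (mulrC d).
- move=> _ /TE[r [r' [ur ur' ->]]].
  have [n n0 hn] := vunit_torsion hv hR ur; have [n' n'0 hn'] := vunit_torsion hv hR ur'.
  have pw a i j : vunit v a -> vge v (a ^+ i - 1) 1 -> vge v (a ^+ (i * j) - 1) 1.
    move=> ua ha; rewrite exprM; elim: j => [|j IH]; first by rewrite subrr; left.
    have -> : (a ^+ i) ^+ j.+1 - 1 = ((a ^+ i) ^+ j - 1) * a ^+ i + (a ^+ i - 1) by rewrite exprSr; ring.
    by apply: (vgeD hv) => //; apply: (vgeMl hv) => //; apply: vunit_vge0; apply: vunitX.
  exists (n * n')%N; first by rewrite muln_gt0 n0.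
  move=> y [_ fy]; rewrite dm_iter //; apply: fy; apply: dm_I1; first exact: pw.
  by rewrite mulnC; apply: pw.
(* The existential stands outside the unit conditions so that [psi] can be chosen as a total
   function, arbitrary off the units. *)
have H a d : exists c, vunit v a -> vunit v d -> rho (dm a d) y = c *: y.
  have [ua|na] := pselect (vunit v a); last by exists 0.
  have [ud|nd] := pselect (vunit v d); last by exists 0.
  have rU b : vunit v b -> rep hR b \in U /\ vunit v (rep hR b) /\ vge v (b / rep hR b - 1) 1.
    move=> ub; have Ob := vunit_vge0 ub; have hb := rep_near hR Ob.
    have ur : vunit v (rep hR b) by apply: (vunit_near hv ub); apply: (vgeBC hv).
    split; first by rewrite mem_filter rep_in // andbT; apply/asboolP.
    split=> //; have r0 := vunit_neq0 ur.
    have -> : b / rep hR b - 1 = (b - rep hR b) / rep hR b by field.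
    by auto with val.
  have [raU [ura ha]] := rU a ua; have [rdU [urd hd]] := rU d ud.
  have [|c ec] := yE (dm (rep hR a) 1); first by rewrite mem_cat (map_f (fun r => dm r 1)).
  have [|c' ec'] := yE (dm 1 (rep hR d)); first by rewrite mem_cat orbC (map_f (fun r => dm 1 r)).
  have G1 := dmGL _ _ ura u1; have G2 := dmGL _ _ u1 urd.
  have I3 := dm_I1 _ _ ha hd; have G3 := I1_GL I3.
  have -> : rho (dm a d) y = rho (dm (rep hR a) 1) (rho (dm 1 (rep hR d)) y).
    rewrite -[in RHS](fy _ I3) rho3 // !dmM; congr (rho (dm _ _) y); field.
      exact: vunit_neq0 ura.
    exact: vunit_neq0 urd.
  by exists (c' * c) => _ _; rewrite ec' linZ ?ec ?scalerA //; apply: rl.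
by exists (fun a d => projT1 (cid (H a d))), y; split=> //; split=> // a d; case: cid.
Qed.

(** If Y and Z shared a nonzero vector, they would share a nonzero I1-fixed one, lying in both A and
    B. So the sum is direct, and invariance can be read off in each summand. *)
Lemma addS_fixI1 (Y Z A B : V -> Prop) : subspace Y -> subspace Z ->
    (forall g y, I1 v g -> Y y -> Y (rho g y)) -> (forall g y, I1 v g -> Z y -> Z (rho g y)) ->
    (forall y, Y y -> fixI1 y -> A y) -> (forall y, Z y -> fixI1 y -> B y) ->
    (forall y, A y -> B y -> y = 0) ->
  forall x, addS Y Z x -> fixI1 x -> addS A B x.
Proof.
move=> sY sZ gY gZ YA ZB AB.
have disj y : Y y -> Z y -> y = 0.
  move=> Yy Zy; apply/eqP/negPn/negP => y0.
  have [||||z [[Yz Zz] z0 fz]] := I1_fixed_vector hv pi0 vpi hR pres pk hrho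
     (Y := fun y => Y y /\ Z y) (x := y) => //.
  - exact: subspaceI.
  - by move=> g z Ig [Yz Zz]; split; [apply: gY|apply: gZ].
  by case/eqP: z0; apply: AB; [apply: YA|apply: ZB].
move=> _ [y [z [Yy Zz ->]]] fyz.
have E g : I1 v g -> rho g y - y = z - rho g z.
  move=> Ig; have := fyz g Ig; rewrite linD; last exact: rl (I1_GL Ig).
  by move=> e; apply/eqP; rewrite subr_eq addrAC -subr_eq opprK e addrC.
have fy : fixI1 y.
  move=> g Ig; apply/eqP; rewrite -subr_eq0; apply/eqP; apply: disj.
    by apply: subspaceB => //; apply: gY.
  by rewrite E //; apply: subspaceB => //; apply: gZ.
have fz : fixI1 z.
  by move=> g Ig; apply/esym/eqP; rewrite -subr_eq0 -E // fy // subrr.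
by exists y, z; split; [apply: YA|apply: ZB|].
Qed.

Lemma val_pi_decomp (a : F) : O a -> a != 0 -> exists n, vunit v (a / pi ^+ n).
Proof.
move=> Oa a0; case: Oa => [/eqP|]; first by rewrite (negPf a0).
case va : (v a) => [n|//] _; exists n.
have e n' : v (pi ^+ n') = n'%:Z.
  elim: n' => [|n' IH]; first by rewrite expr0 valn_one.
  by rewrite exprS valn_mul ?expf_neq0 // IH vpi; lia.
split; first by rewrite mulf_neq0 ?invr_eq0 ?expf_neq0.
by rewrite valn_mul ?invr_neq0 ?expf_neq0 // valn_inv ?expf_neq0 // e va subrr.
Qed.

(** * Proper subspaces stable under the Borel subgroup *)

Section Proper.
Variable W : V -> Prop.
Hypothesis (sW : subspace W) (WB : forall a b d y, a != 0 -> d != 0 -> W y -> W (rho (m2 a b 0 d) y))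
  (Wne : exists x, ~ W x).

(** [W] need not be stable under I1, so the pro-p argument runs on the vectors whose I1-orbit stays
    in [W]. *)
Lemma exists_fixI1 x : W x -> x != 0 -> exists y, [/\ W y, y != 0 & fixI1 y].
Proof.
move=> Wx x0; have [n fx] := rho_smooth hrho x.
have pn0 : pi ^+ n != 0 by rewrite expf_neq0.
have Gn := dm_GL pn0 (oner_neq0 F).
(* Conjugation by diag(pi^n, 1) contracts lower unipotents: those of level 1 act on [x1] as those of
   level n + 1 act on x, that is, trivially. The other factor of an element of I1 is upper
   triangular and preserves [W]. *)
pose x1 := rho (dm (pi ^+ n) 1) x.
have fx1 c : vge v c 1 -> rho (m2 1 0 c 1) x1 = x1.
  move=> pc; rewrite /x1 -(rhoM hrho) //.
  rewrite (_ : _ *m _ = dm (pi ^+ n) 1 *m m2 1 0 (pi ^+ n * c) 1); last by rewrite /dm; m2eq; ring.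
  rewrite (rhoM hrho) // fx //; apply/congr_Lv/Lv_m2; rewrite subrr; split; try by left.
  by rewrite -addn1 PoszD; apply: (vgeMD hv) => //; apply: vgeX.
have [||||y [Yy y0 fy]] := I1_fixed_vector hv pi0 vpi hR pres pk hrho
   (Y := fun y => forall g, I1 v g -> W (rho g y)) (x := x1).
- by apply: subspaceI_all => g /I1_GL/rl gl; apply: subspace_pre.
- move=> g y Ig Yy h Ih; rewrite -(rhoM hrho); [|exact: I1_GL..].
  apply: Yy; move: Ig Ih; elim/m2P: g => a b c d; elim/m2P: h => a' b' c' d'.
  rewrite mulm2 !I1_m2 => -[ha hb hc hd] [ha' hb' hc' hd'].
  have Oa := vunit_vge0 (near1_vunit hv ha); have Od := vunit_vge0 (near1_vunit hv hd).
  have Oa' := vunit_vge0 (near1_vunit hv ha'); have Od' := vunit_vge0 (near1_vunit hv hd').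
  split; auto with val.
    have -> : a' * a + b' * c - 1 = (a' - 1) * a + (a - 1) + b' * c by ring.
    by auto with val.
  have -> : c' * b + d' * d - 1 = c' * b + (d' - 1) * d + (d - 1) by ring.
  by auto with val.
- elim/m2P=> a b c d /I1_m2[ha hb hc hd]; have ud := near1_vunit hv hd; have d0 := vunit_neq0 ud.
  have pcd : vge v (c / d) 1 by auto with val.
  have ua : vunit v (a - b * (c / d)) by apply: (vunitB hv); [exact: (near1_vunit hv ha)|auto with val].
  have a0 := vunit_neq0 ua.
  rewrite (@rhoE _ (m2 (a - b * (c / d)) b 0 d) (m2 1 0 (c / d) 1)) //; last by m2eq; field.
    by rewrite fx1 //; do 2![apply: WB => //; rewrite ?oner_eq0 //].
  exact: upper_GL.
- exact: rho_neq0.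
exists y; split=> //; rewrite -(rho1 hrho y); apply: Yy.
by rewrite scalar_m2; apply/I1_m2; rewrite subrr; split; left.
Qed.

Lemma P_notin y : y != 0 -> fixI1 y -> W y -> ~ W (P y).
Proof.
move=> y0 fy Wy WPy; case: Wne => x; apply; move: x.
apply: irr_cover sW y0 _ => g Gg.
have [[a [b [c [d [a0 d0 pc ->]]]]]|[a [b [d [e [a0 d0 Oe ->]]]]]] := Borel_I1_decomp Gg.
  rewrite (rhoM hrho) //; last exact: upper_GL.
  by rewrite (fy _ (lower_I1 pc)); apply: WB.
have Gb := upper_GL b a0 d0; have GPe := GLM P_GL (um_GL e).
rewrite !(rhoM hrho) //.
by rewrite fix_um //; apply: WB.
Qed.

Lemma W_hecke y : W y -> W (hecke y).
Proof.
move=> Wy; apply: subspace_sum => // x _.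
by do 2![apply: WB; rewrite ?oner_eq0 //].
Qed.

Lemma sum_single (f : F -> V) x : x \in R -> (forall r, r \in R -> r != x -> f r = 0) ->
  \sum_(r <- R) f r = f x.
Proof.
move=> xR f0; have [uR _ _ _] := hR.
rewrite (bigD1_seq x) //= big_seq_cond big1 ?addr0 // => r /andP[rR rx].
exact: f0.
Qed.

(** * Algebraicity under the Hecke operator *)

Section Algebraicity.
Variables (psi : F -> F -> k) (w : V).
Hypothesis (Ww : W w) (Ew : torus_eigen psi w)
  (free : forall n (c : nat -> k), \sum_(i < n) c i *: iter i hecke w = 0 ->
     forall i, (i < n)%N -> c i = 0).

Let w1 := P w.
Let m := s w1.
Let w2 := hecke w.
Let m1 := s w2.

Let iterS_neq0 i : iter i hecke w != 0.
Proof.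
apply/eqP => e; suff /(_ i (ltnSn i))/eqP : forall j, (j < i.+1)%N -> ((j == i)%:R : k) = 0.
  by rewrite eqxx oner_eq0.
apply: (free (n := i.+1) (c := fun j => (j == i)%:R)).
by apply: big1 => j _; case: eqP => [->|_]; rewrite ?e ?scaler0 ?scale0r.
Qed.

Let fw : fixI1 w. Proof. by case: Ew. Qed.
Let fw1 : fixI1 w1. Proof. exact: P_fixI1. Qed.
Let fw2 : fixI1 w2. Proof. exact: hecke_fixI1. Qed.

(** Because t = s Pi, the vector T w arises from the I1-fixed vector P w by an operator from GL2(O);
    the structure of [sigma] becomes a computation over the residue field. *)
Let t_sP y : t y = s (P y).
Proof. by rewrite -(rhoM hrho) //; congr (rho _ y); rewrite /dm /sm /Pim; m2eq; ring. Qed.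

Let w2E : w2 = \sum_(x <- R) u x m.
Proof. by apply: eq_bigr => x _; rewrite t_sP. Qed.

Let um_s a y : u a (s y) = s (rho (m2 1 0 a 1) y).
Proof. by rewrite -!(rhoM hrho) //; congr (rho _ y); rewrite /um /sm; m2eq; ring. Qed.

Let m_fix a : vge v a 1 -> u a m = m.
Proof. by move=> pa; rewrite um_s fw1 //; apply: lower_I1. Qed.

Let m_periodic x x' : vge v (x - x') 1 -> u x m = u x' m.
Proof. by move=> /m_fix h; rewrite -[in RHS]h (umD hrho) addrC subrK. Qed.

Let m0 : m != 0.
Proof.
have w0 : w != 0 := iterS_neq0 0.
by do 2![apply: rho_neq0 => //].
Qed.

Let um_linear x : lin (u x). Proof. exact: rl. Qed.

(** [translates_fixed] for the line of [m]; the nonvanishing that it asks for is that of T w. *)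
Let const_of_fixed (d : F -> k) :
  (forall a, O a -> u a (\sum_(x <- R) u x (d x *: m)) = \sum_(x <- R) u x (d x *: m)) ->
  exists c, forall x, x \in R -> d x = c.
Proof.
move=> fx; have [||||||c ec] := translates_fixed hv pi0 vpi hR pres pk hrho
   (X := fun y => exists c, y = c *: m) (m := m) _ _ _ _ (y := fun x => d x *: m) => //.
- exact: subspace_line.
- by move=> a _ pa [c ->]; exists c; rewrite linZ // m_fix.
- by rewrite -w2E; apply: (iterS_neq0 1).
- by move=> x _; exists (d x).
exists c => x /ec/eqP; rewrite -subr_eq0 -scalerBl scaler_eq0 (negPf m0) orbF subr_eq0.
by move/eqP.
Qed.

Let Y y := exists d : F -> k, y = \sum_(x <- R) u x (d x *: m).

Let sY : subspace Y.
Proof.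
split; first by exists (fun=> 0); rewrite big1 // => x _; rewrite scale0r (lin0 (um_linear x)).
move=> a _ _ [d ->] [d' ->]; exists (fun x => a * d x + d' x).
rewrite scaler_sumr -big_split /=; apply: eq_bigr => x _.
by rewrite scalerDl -scalerA um_linear.
Qed.

Let Yu x : O x -> Y (u x m).
Proof.
move=> Ox; exists (fun r => (r == rep hR x)%:R).
have rR := rep_in hR Ox; rewrite (sum_single rR) => [|r _ /negPf->].
  by rewrite eqxx scale1r; apply: m_periodic; apply: rep_near.
by rewrite scale0r (lin0 (um_linear _)).
Qed.

Let Y_um a y : O a -> Y y -> Y (u a y).
Proof.
move=> Oa [d ->]; rewrite (lin_sum _ _ _ (um_linear a)); apply: subspace_sum => // x xR.
rewrite (umD hrho) linZ //; apply: subspaceZ => //; apply: Yu.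
by apply: (vgeD hv) => //; apply: (R_vge0 hR).
Qed.

Let D x := if `[< vunit v x >] then psi (- x) x^-1 else 0.

(** The matrix s u(x) s is lower unipotent. For x in the maximal ideal it fixes [w1]; for a unit x
    the Bruhat decomposition and the torus eigenvalue of w produce the coefficient [D]. *)
Let m1E : m1 - w1 = \sum_(x <- R) u x (D x *: m).
Proof.
pose f x := s (u x m).
have fE x : f x = rho (m2 1 0 x 1) w1.
  by rewrite /f /m rho3 //; congr (rho _ w1); rewrite /sm /um; m2eq; ring.
(* The substitution x -> 1/x on units, extended by the identity so that it is injective on all
   residues, as [sum_reindex] requires. *)
pose h x := if `[< vunit v x >] then x^-1 else x.
have hU x : vunit v x -> h x = x^-1 by move=> /asboolP; rewrite /h => ->.
have hN x : ~ vunit v x -> h x = x by move=> /asboolPn/negPf; rewrite /h => ->.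
have DU x : vunit v x -> D x = psi (- x) x^-1 by move=> /asboolP; rewrite /D => ->.
have DN x : ~ vunit v x -> D x = 0 by move=> /asboolPn/negPf; rewrite /D => ->.
have -> : m1 = \sum_(x <- R) f x by rewrite /m1 w2E (lin_sum _ _ _ (rl s_GL)).
rewrite -(sum_reindex hv hR (h := h) (f := f) (phi := fun x => f (h x))) //; first last.
- by move=> x x' _ xx'; rewrite /f (m_periodic xx').
- have near x x' : vunit v x -> vge v (x - x') 1 -> vunit v x'.
    by move=> ux xx'; apply: (vunit_near hv ux); apply: (vgeBC hv).
  have nearV x x' : vunit v x -> vge v (x - x') 1 -> vunit v x' /\ vge v (x^-1 - x'^-1) 1.
    by move=> ux xx'; split; [exact: near xx'|apply: (vgeV_near hv) => //; exact: near xx'].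
  move=> x x' Ox Ox'; have [ux|nx] := pselect (vunit v x); last first.
    rewrite (hN x) //; have [ux'|nx'] := pselect (vunit v x'); last by rewrite hN.
    rewrite hU // => h'; case: nx; apply: (vunit_near hv) h'; exact: vunitV.
  rewrite (hU x) //; have [ux'|nx'] := pselect (vunit v x').
    by rewrite hU // => h'; rewrite -[x]invrK -[x']invrK; apply: (vgeV_near hv) h'; apply: vunitV.
  by rewrite hN // => h'; case: nx'; apply: near h'; apply: vunitV.
- move=> x Ox; have [ux|nx] := pselect (vunit v x); last by rewrite hN.
  by rewrite hU //; auto with val.
have -> : w1 = \sum_(x <- R) (if `[< vunit v x >] then 0 else w1).
  have O0 : O 0 by left.
  rewrite (sum_single (rep_in hR O0)) => [|r rR r0].
    by case: asboolP => // /(vunit_not_vge1)[]; have := rep_near hR O0; rewrite sub0r => /(vgeN hv); rewrite opprK.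
  case: asboolP => // nr; case/eqP: r0; apply: (R_near_eq hR) => //; first exact: rep_in.
  have [//|pr] := vunitP hv (R_vge0 hR rR).
  by apply: (vgeB hv) => //; have := rep_near hR O0; rewrite sub0r => /(vgeN hv); rewrite opprK.
rewrite -sumrB; apply: eq_big_seq => x xR.
have [ux|nx] := pselect (vunit v x).
  have [_ torus_w] := Ew; have x0 := vunit_neq0 ux; have xV0 : x^-1 != 0 by rewrite invr_eq0.
  have nx0 : - x != 0 by rewrite oppr_eq0.
  have unx := vunitN hv ux; have uxV := vunitV hv ux; have Ox := vunit_vge0 ux.
  move/asboolP: (ux) => ->; rewrite subr0 hU // DU // fE.
  have -> : rho (m2 1 0 x^-1 1) w1 = u x (s (rho (dm x^-1 (- x)) (u x w1))).
    have G1 := dm_GL xV0 nx0.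
    rewrite rho4 //.
    by congr (rho _ w1); rewrite /um /dm /sm; m2eq; field.
  by rewrite (fix_um fw1) // dm_P // torus_w // !linZ // -/w1 -/m; apply: rl.
have -> : `[< vunit v x >] = false by apply/asboolPn.
rewrite hN // DN // scale0r (lin0 (um_linear x)) fE fw1 ?subrr //.
by apply: lower_I1; case: (vunitP hv (R_vge0 hR xR)).
Qed.

(** Invariance would make [D] constant on residues, but it vanishes at the residue 0 and is a torus
    eigenvalue, hence nonzero, at the residue 1. *)
Let m1_not_fixed : ~ (forall a, O a -> u a m1 = m1).
Proof.
move=> fm1; have [a Oa|c dc] := const_of_fixed (d := D).
  by rewrite -m1E linB // fm1 // (fix_um fw1).
have [O0 O1] : O 0 /\ O 1 by split; [left|apply: vge1].
have near0 : vge v (rep hR 0) 1.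
  by have := rep_near hR O0; rewrite sub0r => /(vgeN hv); rewrite opprK.
have u1 : vunit v (rep hR 1).
  by apply: (vunit_near hv) (vgeBC hv (rep_near hR O1)); apply: vunit1.
have c0 : c = 0.
  by rewrite -(dc _ (rep_in hR O0)) /D; case: asboolP => // /vunit_not_vge1[].
have /eqP := dc _ (rep_in hR O1); rewrite c0 /D; move/asboolP: (u1) => ->.
move=> /eqP e; have [_ /(_ (- rep hR 1) (rep hR 1)^-1)] := Ew.
rewrite e scale0r => /(_ (vunitN hv u1) (vunitV hv u1))/eqP; apply/negP; apply: rho_neq0 (iterS_neq0 0).
by apply: dm_GL; rewrite ?oppr_eq0 ?invr_eq0 (vunit_neq0 u1).
Qed.

(* The span of the GL2(O)-translates of [w2]; see [sigma_KO]. *)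
Definition sigma z := exists (c : k) (d : F -> k), z = c *: w2 + \sum_(x <- R) d x *: u x m1.

Lemma subspace_sigma : subspace sigma.
Proof.
split; first by exists 0, (fun=> 0); rewrite scale0r add0r big1 // => x _; rewrite scale0r.
move=> a _ _ [c [d ->]] [c' [d' ->]]; exists (a * c + c'), (fun x => a * d x + d' x).
rewrite scalerDr scalerA addrACA -scalerDl; congr (_ + _).
rewrite scaler_sumr -big_split /=; apply: eq_bigr => x _.
by rewrite scalerA scalerDl.
Qed.

Let um_m1 a : vge v a 1 -> u a m1 = m1.
Proof. by move=> pa; rewrite um_s fw2 //; apply: lower_I1. Qed.

Lemma sigma_w2 : sigma w2.
Proof.
exists 1, (fun=> 0); rewrite scale1r big1 ?addr0 // => x _.
by rewrite scale0r.
Qed.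

Let sigma_m1 x : O x -> sigma (u x m1).
Proof.
move=> Ox; exists 0, (fun r => (r == rep hR x)%:R).
have rR := rep_in hR Ox; rewrite scale0r add0r (sum_single rR) => [|r _ /negPf->].
  by rewrite eqxx scale1r -[in RHS](um_m1 (rep_near hR Ox)) (umD hrho) addrC subrK.
by rewrite scale0r.
Qed.

(** Bruhat decomposition over the residue field: a translate of [w2] is a multiple of some u(x) [m1]
    if the lower left entry of the matrix is a unit, and a multiple of [w2] otherwise. *)
Lemma sigma_KO g z : KO v g -> sigma z -> sigma (rho g z).
Proof.
move=> Kg; have K2 h : KO v h -> sigma (rho h w2).
  elim/m2P: h => a b c d /KO_m2[Oa Ob Oc Od udet].
  have [uc|pc] := vunitP hv Oc.
    have c0 := vunit_neq0 uc; set e := - (a * d - b * c) / c.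
    have ue : vunit v e by apply: vunitM => //; [apply: vunitN|apply: vunitV].
    have e0 := vunit_neq0 ue; have G1 : GL2 (m2 c d 0 e) by apply: upper_GL.
    have -> : rho (m2 a b c d) w2 = u (a / c) (s (rho (dm c e) (u (d / c) w2))).
      have G2 := dm_GL c0 e0; rewrite rho4 //.
      by congr (rho _ w2); rewrite /um /sm /dm /e; m2eq; field.
    rewrite (fix_um fw2); last by auto with val.
    have [_ ->] := hecke_torus_eigen Ew; rewrite // !linZ //; last exact: rl.
    apply: subspaceZ; first exact: subspace_sigma.
    by apply: sigma_m1; auto with val.
  have ua : vunit v a.
    have [//|pa] := vunitP hv Oa; case: (vunit_not_vge1 udet).
    by auto with val.
  have ud : vunit v d.
    have [//|pd] := vunitP hv Od; case: (vunit_not_vge1 udet).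
    by auto with val.
  have [a0 d0] := (vunit_neq0 ua, vunit_neq0 ud).
  set e := (a * d - b * c) / d; have ue : vunit v e by apply: vunitM => //; apply: vunitV.
  have e0 := vunit_neq0 ue.
  have -> : rho (m2 a b c d) w2 = u (b / d) (rho (dm e d) (rho (m2 1 0 (c / d) 1) w2)).
    have G2 := dm_GL e0 d0; rewrite rho3 //.
    by congr (rho _ w2); rewrite /um /dm /e; m2eq; field.
  rewrite (fw2 (lower_I1 _)); last by auto with val.
  have [_ ->] := hecke_torus_eigen Ew; rewrite // linZ // (fix_um fw2); last by auto with val.
  by apply: subspaceZ; [exact: subspace_sigma|exact: sigma_w2].
have Gg := KO_GL2 Kg; have gl := rl Gg.
move=> [c [d ->]]; rewrite linD // linZ //.
apply: (subspaceD subspace_sigma); first by apply: (subspaceZ _ subspace_sigma); apply: K2.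
rewrite (lin_sum _ _ _ gl).
apply: (subspace_sum subspace_sigma) => x xR; rewrite linZ //; apply: (subspaceZ _ subspace_sigma).
have Ox := R_vge0 hR xR.
have Ku : KO v (um x) by apply/KO_m2; rewrite mulr1 mulr0 subr0; split; auto with val.
have Ks : KO v (@sm F).
  by apply/KO_m2; rewrite mulr1 mulr0 sub0r; split; auto with val.
rewrite rho3 //; by apply: K2; apply: KOM => //; apply: KOM.
Qed.

(** On vectors fixed by N(pi), [A] acts as an element of the group algebra of the residue field, a
    local ring in characteristic p with augmentation [e]. If e = 0, then A kills [w1], and A m1 = A
    (m1 - w1) lies in the span of the u(x) m, whose invariants are known. If e is nonzero, A is
    injective, and invariance of A m1 would pass to [m1]. *)
Lemma sigma_fixed z : sigma z -> (forall a, O a -> u a z = z) -> exists c, z = c *: w2.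
Proof.
move=> [c0 [d ez]] fz.
pose A y := \sum_(x <- R) d x *: u x y.
have Al : lin A.
  move=> a x y; rewrite /A scaler_sumr -big_split; apply: eq_bigr => r _ /=.
  by rewrite um_linear scalerDr !scalerA mulrC.
have Au a y : u a (A y) = A (u a y).
  rewrite (lin_sum _ _ _ (um_linear a)); apply: eq_bigr => x _.
  by rewrite linZ // !(umD hrho) addrC.
pose e := \sum_(x <- R) d x.
have Afix y : (forall a, O a -> u a y = y) -> A y = e *: y.
  move=> fy; rewrite scaler_suml; apply: eq_big_seq => x xR.
  by rewrite fy //; apply: (R_vge0 hR).
have fA a : O a -> u a (A m1) = A m1.
  move=> Oa; have -> : A m1 = z - c0 *: w2 by rewrite ez addrC addKr.
  by rewrite linB // fz // linZ // (fix_um fw2).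
suff [c ec] : exists c, A m1 = c *: w2.
  by exists (c0 + c); rewrite ez -/(A m1) ec scalerDl.
have [e0|e0] := eqVneq e 0.
  have [b eb] : Y (A m1).
    have -> : A m1 = A (m1 - w1).
      by rewrite linB // (Afix w1) ?e0 ?scale0r ?subr0 // => a; apply: fix_um.
    apply: subspace_sum => // x xR; apply: subspaceZ => //; apply: Y_um; first exact: (R_vge0 hR).
    by exists D; apply: m1E.
  have [a Oa|c ec] := const_of_fixed (d := b); first by rewrite -eb fA.
  exists c; rewrite eb w2E scaler_sumr; apply: eq_big_seq => x xR.
  by rewrite ec // linZ.
(* Here e is nonzero. A nonzero u(a) m1 - m1 would lie in the kernel of [A], which would then
   contain a nonzero invariant y, although A y = e y. *)
case: m1_not_fixed => a Oa; apply/eqP; rewrite -subr_eq0; apply/negPn/negP => d0.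
have [|||||||y [[fy Ay] y0 yE]] := @fixed_vector_step k V p _ (fun x => rho (um x)) (fun x => O x) R
   (fun y => (forall b, vge v b 1 -> u b y = y) /\ A y = 0) (u a m1 - m1) pk _ _ d0.
- apply: subspaceI; last by split=> [|b x y hx hy]; rewrite ?(lin0 Al) // Al hx hy scaler0 addr0.
  by apply: subspaceI_all => b _; apply: subspace_eqlin.
- split; last by rewrite linB // -Au fA // subrr.
  by move=> b pb; rewrite linB // (umD hrho) (addrC b) -(umD hrho) um_m1.
- by move=> g _; apply: um_linear.
- move=> g y Og [fy Ay]; split; last by rewrite -Au Ay (lin0 (um_linear g)).
  by move=> b pb; rewrite (umD hrho) addrC -(umD hrho) fy.
- by move=> g h y _ _ _; rewrite !(umD hrho) addrC.
- move=> g y Og [fy _].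
  have itE i : iter i (rho (um g)) y = u (i%:R * g) y.
    elim: i => [|i IH]; first by rewrite mul0r (um0 hrho).
    by rewrite iterS IH (umD hrho) -addn1 natrD mulrDl mul1r addrC.
  by rewrite itE fy //; apply: (vgeMl hv).
- move=> g Og; exists (rep hR g); split; first exact: rep_in.
    by apply: (R_vge0 hR); apply: rep_in.
  by move=> y [fy _]; rewrite -[in RHS](fy _ (rep_near hR Og)) (umD hrho) addrC subrK.
by case/eqP: y0; apply/eqP; move/eqP: Ay; rewrite Afix // scaler_eq0 (negPf e0).
Qed.

(* [sphere n] sums the translates of [sigma] at the vertices at distance [n] from the origin in
   the half tree of the discs contained in O. *)
Fixpoint sphere n : V -> Prop :=
  if n is n'.+1 then fun y => exists z : F -> V,
    (forall r, r \in R -> sphere n' (z r)) /\ y = \sum_(r <- R) u r (t (z r))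
  else sigma.

Fixpoint ball n : V -> Prop :=
  if n is n'.+1 then addS (ball n') (sphere n'.+1) else sigma.

Lemma subspace_sphere n : subspace (sphere n).
Proof.
elim: n => [|n IH]; first exact: subspace_sigma.
split.
  exists (fun=> 0); split=> [r _|]; first exact: subspace0.
  by rewrite big1 // => r _; rewrite (lin0 (rl t_GL)) (lin0 (um_linear r)).
move=> a _ _ [z [Cz ->]] [z' [Cz' ->]]; exists (fun r => a *: z r + z' r); split=> [r rR|].
  by case: IH => _ IHD; apply: IHD; [exact: Cz|exact: Cz'].
rewrite scaler_sumr -big_split /=; apply: eq_bigr => r _.
by rewrite (rl t_GL) um_linear.
Qed.

Lemma subspace_ball n : subspace (ball n).
Proof.
elim: n => [|n IH]; first exact: subspace_sigma.
by apply: subspace_addS => //; apply: subspace_sphere.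
Qed.

(** Stability of [sphere n] is a hypothesis since this is used inside the induction that proves it.
    The shift from x to its representative passes through t into I1. *)
Let sphere_single n x z : (forall g z, I1 v g -> sphere n z -> sphere n (rho g z)) ->
  O x -> sphere n z -> sphere n.+1 (u x (t z)).
Proof.
move=> stab Ox Cz; have rR := rep_in hR Ox.
exists (fun r => if r == rep hR x then u ((x - rep hR x) / pi) z else 0); split.
  move=> r _; case: eqP => _; last exact: (subspace0 (subspace_sphere n)).
  by apply: stab => //; apply: um_I1; apply: divpi_O; apply: rep_near.
rewrite (sum_single rR) => [|r _ /negPf->].
  by rewrite eqxx -ut_shift addrC subrK.
by rewrite (lin0 (rl t_GL)) (lin0 (um_linear r)).
Qed.

Lemma sphere_I1 n g z : I1 v g -> sphere n z -> sphere n (rho g z).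
Proof.
elim: n g z => [|n IH] g z Ig; first by apply: sigma_KO; exact: (Lv_KO hv _ Ig).
move=> [z' [Cz ->]]; rewrite (lin_sum _ _ _ (rl (I1_GL Ig))).
apply: (subspace_sum (subspace_sphere n.+1)) => r rR.
have [x' Ox' [_ ut]] := I1_ut Ig (R_vge0 hR rR).
have [|h Ih ->] := ut x'; first by rewrite subrr; left.
by apply: sphere_single => //; apply: IH => //; apply: Cz.
Qed.

Lemma ball_I1 n g z : I1 v g -> ball n z -> ball n (rho g z).
Proof.
move=> Ig; elim: n z => [|n IH] z; first exact: (@sphere_I1 0).
move=> [x [y [Bx Cy ->]]]; rewrite linD; last exact: rl (I1_GL Ig).
by exists (rho g x), (rho g y); split; [apply: IH|apply: sphere_I1|].
Qed.

Lemma sphere_ut n x z : O x -> sphere n z -> sphere n.+1 (u x (t z)).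
Proof. by apply: sphere_single => g ?; apply: sphere_I1. Qed.

(** [translates_fixed] with X = t (sphere n): the vectors of X fixed by N(pi) are the t z with z
    fixed by N(O), known by induction. The nonvanishing required is that of T^(n+2) w, which
    freeness provides. *)
Lemma sphere_fixed n y : sphere n y -> (forall a, O a -> u a y = y) ->
  exists c, y = c *: iter n hecke w2.
Proof.
elim: n y => [|n IH] y; first exact: sigma_fixed.
move=> [z [Cz ->]] fy.
have tl := rl t_GL.
have t_um a x : t (u a x) = u (a * pi) (t x).
  by rewrite dm_um ?oner_eq0 // divr1 mulrC.
have [||||z' Cz'|//|c ec] := translates_fixed hv pi0 vpi hR pres pk hrho
   (X := fun y => exists2 z, sphere n z & y = t z) (m := t (iter n hecke w2)) _ _ _ _ (y := fun r => t (z r)).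
- split; first by exists 0; [exact: (subspace0 (subspace_sphere n))|rewrite (lin0 tl)].
  move=> a _ _ [x Cx ->] [x' Cx' ->]; exists (a *: x + x'); last by rewrite tl.
  by case: (subspace_sphere n) => _; apply.
- move=> a _ pa [x Cx ->]; exists (u (a / pi) x).
    by apply: sphere_I1 => //; apply: um_I1; apply: divpi_O.
  by rewrite t_um divfK.
- move=> _ [x Cx ->] fx; have [|c ->] := IH x Cx; last by exists c; rewrite linZ.
  move=> a Oa; apply: (rho_inj t_GL); rewrite t_um fx //.
  by apply: (vgeMr hv) pi_vge.
- by have := iterS_neq0 n.+2; rewrite iterSr.
- by exists (z z'); first exact: Cz.
exists c; rewrite iterS {1}/hecke scaler_sumr; apply: eq_big_seq => r rR.
by rewrite ec // linZ.
Qed.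

Let free2 n (c : nat -> k) : \sum_(i < n) c i *: iter i hecke w2 = 0 ->
  forall i, (i < n)%N -> c i = 0.
Proof.
move=> e i lt_i; apply: (free (n := n.+1) (c := fun i => if i is j.+1 then c j else 0) _ (i := i.+1)) => //.
rewrite big_ord_recl scale0r add0r -[RHS]e; apply: eq_bigr => j _.
by rewrite /= -iterSr.
Qed.

(** Since [w2] is T w, this is the span of the T^i w with 0 < i <= n + 1. That [w] is left out is
    what [not_free] exploits. *)
Let A n y := exists c : nat -> k, y = \sum_(i < n.+1) c i *: iter i hecke w2.

Let iter_good i : W (iter i hecke w2) /\ fixI1 (iter i hecke w2).
Proof. by elim: i => [|i [Wi fi]]; split=> //; [exact: W_hecke|exact: W_hecke|exact: hecke_fixI1]. Qed.

Let A_good n y : A n y -> W y /\ fixI1 y.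
Proof.
move=> [c ->]; split.
  by apply: subspace_sum => // i _; apply: subspaceZ => //; case: (iter_good i).
apply: (subspace_sum subspace_fixI1) => i _; apply: (subspaceZ _ subspace_fixI1).
by case: (iter_good i).
Qed.

(** Each sphere adds at most one line of invariants, and freeness keeps T^(n+1) w2 outside [A n],
    which is the disjointness that [addS_fixI1] asks for. *)
Let ball_fixed n y : ball n y -> fixI1 y -> A n y.
Proof.
have um_fix z : fixI1 z -> forall a, O a -> u a z = z by move=> fz a; apply: fix_um.
elim: n y => [|n IH] y.
  move=> By /um_fix/(sigma_fixed By)[c ->]; exists (fun=> c).
  by rewrite big_ord1.
move=> By fy; have [|||||z [z' [[c ->] [c' ->] ->]]] := addS_fixI1 (A := A n)
    (B := fun y => exists c, y = c *: iter n.+1 hecke w2) (subspace_ball n) (subspace_sphere n.+1) _ _ _ _ _ By fy.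
- by move=> g z; apply: ball_I1.
- by move=> g z; apply: sphere_I1.
- exact: IH.
- by move=> z Cz /um_fix; apply: sphere_fixed.
- move=> _ [c ->] [c' e].
  have c'0 : c' = 0.
    apply/oppr_inj; rewrite oppr0.
    have := @free2 n.+2 (fun i => if (i < n.+1)%N then c i else - c') _ n.+1 (ltnSn _).
    rewrite ltnn; apply; rewrite big_ord_recr /= ltnn scaleNr -e; apply/eqP; rewrite subr_eq0; apply/eqP.
    by apply: eq_bigr => i _; rewrite /= ltn_ord.
  by rewrite e c'0 scale0r.
exists (fun i => if (i < n.+1)%N then c i else c'); rewrite [RHS]big_ord_recr /= ltnn; congr (_ + _).
by apply: eq_bigr => i _; rewrite /= ltn_ord.
Qed.

Let Pball n y := exists2 x, ball n x & y = P x.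

Let total y := exists n, addS (ball n) (Pball n) y.

Let ball_leq n n' y : (n <= n')%N -> ball n y -> ball n' y.
Proof.
move=> /subnK <-; elim: (n' - n)%N => [//|i IH] /IH By.
by exists y, 0; split; rewrite ?addr0 //; apply: (subspace0 (subspace_sphere _)).
Qed.

Let subspace_Pball n : subspace (Pball n).
Proof.
split; first by exists 0; [exact: (subspace0 (subspace_ball n))|rewrite (lin0 (rl P_GL))].
move=> a _ _ [x Bx ->] [x' Bx' ->]; exists (a *: x + x'); last by rewrite (rl P_GL).
by case: (subspace_ball n) => _; apply.
Qed.

Let subspace_total : subspace total.
Proof.
split; first by exists 0%N; apply: subspace0; apply: subspace_addS => //; apply: subspace_sigma.
have mono n n' y : (n <= n')%N -> addS (ball n) (Pball n) y -> addS (ball n') (Pball n') y.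
  move=> le_n [x [_ [Bx [z Bz ->] ->]]]; exists x, (P z); split=> //; first exact: ball_leq Bx.
  by exists z => //; apply: ball_leq Bz.
move=> a x y [n Bx] [n' By]; exists (maxn n n').
have [_ BD] := subspace_addS (subspace_ball (maxn n n')) (subspace_Pball (maxn n n')).
by apply: BD; [apply: mono Bx; apply: leq_maxl|apply: mono By; apply: leq_maxr].
Qed.

Let sphere_ball n y : sphere n y -> ball n y.
Proof.
case: n => [//|n] Cy; exists 0, y; split; rewrite ?add0r //.
exact: (subspace0 (subspace_ball n)).
Qed.

Let total_ball n y : ball n y -> total y.
Proof. by move=> By; exists n, y, 0; split; rewrite ?addr0 //; apply: (subspace0 (subspace_Pball n)). Qed.

Let total_Pball n y : ball n y -> total (P y).
Proof.
move=> By; exists n, 0, (P y); split; rewrite ?add0r //; last by exists y.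
exact: (subspace0 (subspace_ball n)).
Qed.

(** The matrix stands for the disc b + a O inside O. Each factor u(r) t peels off one digit of b,
    and the valuation of a counts them. *)
Let near_vertex (a b : F) z : a != 0 -> O a -> O b -> sigma z ->
  exists n, sphere n (rho (m2 a b 0 1) z).
Proof.
move=> a0 Oa Ob sz; have [n] := val_pi_decomp Oa a0; exists n.
elim: n a b a0 {Oa} Ob p0 => [|n IH] a b a0 Ob; rewrite ?expr0 ?divr1 => ua.
  apply: sigma_KO => //; apply/KO_m2; rewrite mulr1 mulr0 subr0.
  by split; auto with val.
have -> : rho (m2 a b 0 1) z = u (rep hR b) (t (rho (m2 (a / pi) ((b - rep hR b) / pi) 0 1) z)).
  have G : GL2 (m2 (a / pi) ((b - rep hR b) / pi) 0 1).
    by apply: upper_GL; rewrite ?oner_eq0 // mulf_neq0 // invr_eq0.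
  by rewrite rho3 //; congr (rho _ z); rewrite /um /dm; m2eq; field.
apply: sphere_ut; first by apply: (R_vge0 hR); apply: rep_in.
apply: IH; first by rewrite mulf_neq0 // invr_eq0.
  by apply: divpi_O; apply: rep_near.
by move: ua; rewrite exprS invfM mulrA.
Qed.

Let total_Z z y : z != 0 -> total y -> total (rho z%:M y).
Proof. by move=> z0 Ty; rewrite hZ //; apply: subspaceZ. Qed.

Let scalar_GL (z : F) : z != 0 -> GL2 (z%:M : 'M_2).
Proof. by move=> z0; rewrite scalar_m2; apply: dm_GL. Qed.

(* [m2 a b 0 1] runs through the vertices of the tree; those outside the half tree
   [O a, O b] lie in the opposite half tree, which [Pim] exchanges with it. *)
Let total_vertex (a b : F) z : a != 0 -> sigma z -> total (rho (m2 a b 0 1) z).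
Proof.
move=> a0 sz; have [[Oa Ob]|far] := pselect (O a /\ O b).
  by have [n /sphere_ball/total_ball] := near_vertex a0 Oa Ob sz.
have Gab : GL2 (m2 a b 0 1) by apply: upper_GL; rewrite ?oner_eq0.
have nO x : x != 0 -> ~ O x -> O (x^-1 / pi).
  move=> x0 nOx; right; rewrite valn_mul ?invr_neq0 // !valn_inv // vpi.
  have [h|h] := leP 0 (v x); first by case: nOx; right.
  lia.
(* Not being contained in O, the disc b + a O either contains 0, and then O, or misses O altogether.
   [Pim] acts on points by x -> 1 / (pi x); in both cases the vertex is the image under it, up to
   scalars and GL2(O), of a disc inside O. *)
have [h|h] := pselect (O (b / a)).
  have nOa : ~ O a.
    move=> Oa; apply: far; split=> //.
    by rewrite (_ : b = b / a * a); [auto with val|field].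
  have a'0 : a^-1 / pi != 0 by rewrite mulf_neq0 ?invr_eq0.
  have Oa' := nO _ a0 nOa.
  have -> : rho (m2 a b 0 1) z = rho a%:M (P (rho (m2 (a^-1 / pi) 0 0 1) (s (u (b / a) z)))).
    have G1 := scalar_GL a0; have G2 : GL2 (m2 (a^-1 / pi) 0 0 1) by apply: dm_GL; rewrite ?oner_eq0.
    have G4 := GLM G1 (GLM P_GL (GLM G2 s_GL)); rewrite rho4 // -(rhoM hrho) //.
    by congr (rho _ z); rewrite scalar_m2 /Pim /sm /um; m2eq; field; rewrite ?a0 ?pi0.
  apply: total_Z => //.
  have [|n /sphere_ball/total_Pball//] := near_vertex a'0 Oa' (vge0 _ _) (z := s (u (b / a) z)).
  apply: sigma_KO; last apply: sigma_KO => //; apply/KO_m2; rewrite ?mulr1 ?mulr0 ?sub0r ?subr0; split; auto with val.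
have b0 : b != 0 by apply/eqP => b0; apply: h; rewrite b0 mul0r; left.
have pab : vge v (a / b) 1.
  right; rewrite valn_mul ?invr_neq0 // valn_inv //.
  have [h'|h'] := leP 0 (v b - v a); last lia.
  by case: h; right; rewrite valn_mul ?invr_neq0 // valn_inv.
have nOb : ~ O b.
  move=> Ob; apply: far; split=> //.
  by rewrite (_ : a = a / b * b); [apply: (vgeMl hv) => //; apply: vge01|field].
have Ob' := nO _ b0 nOb.
have a'0 : a / b * (b^-1 / pi) != 0 by rewrite !mulf_neq0 ?invr_eq0.
have Oa' : O (a / b * (b^-1 / pi)) by auto with val.
have Kk : KO v (m2 (-1) 0 (a / b) 1).
  by apply/KO_m2; rewrite mulr1 mul0r subr0; split; auto with val.
have -> : rho (m2 a b 0 1) z = rho b%:M (P (rho (m2 (a / b * (b^-1 / pi)) (b^-1 / pi) 0 1)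
    (rho (m2 (-1) 0 (a / b) 1) z))).
  have G1 := scalar_GL b0; have G2 := KO_GL2 Kk.
  have G3 : GL2 (m2 (a / b * (b^-1 / pi)) (b^-1 / pi) 0 1) by apply: upper_GL; rewrite ?oner_eq0.
  by rewrite rho4 //; congr (rho _ z); rewrite scalar_m2 /Pim; m2eq; field; rewrite ?b0 ?pi0.
apply: total_Z => //.
have [|n /sphere_ball/total_Pball//] := near_vertex a'0 Oa' Ob' (z := rho (m2 (-1) 0 (a / b) 1) z).
exact: sigma_KO.
Qed.

(** Iwasawa decomposition: every matrix is a scalar times some [m2 a b 0 1] times an element of
    GL2(O), and the last factor preserves [sigma]. *)
Let total_all x : total x.
Proof.
move: x; apply: irr_cover subspace_total (iterS_neq0 1) _ => g Gg.
suff [e [a [b [h [e0 a0 Kh eg]]]]] : exists e a b h, [/\ e != 0, a != 0, KO v h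
    & g = e%:M *m (m2 a b 0 1 *m h)].
  have G1 := scalar_GL e0; have G2 := KO_GL2 Kh.
  have G3 : GL2 (m2 a b 0 1) by apply: upper_GL; rewrite ?oner_eq0.
  rewrite eg -rho3 //; apply: total_Z => //; apply: total_vertex => //.
  by apply: sigma_KO => //; apply: sigma_w2.
move: Gg; elim/m2P: g => a b c d Gg; have det0 : a * d - b * c != 0 by apply/GL2_m2.
case: (val_dichotomy (GL2_row Gg)) => [[d0 pcd]|[c0 Odc]].
  exists d, ((a * d - b * c) / d / d), (b / d), (m2 1 0 (c / d) 1); split=> //.
  - by rewrite !mulf_neq0 ?invr_eq0.
  - by apply/KO_m2; rewrite mulr1 mul0r subr0; split; auto with val.
  by rewrite scalar_m2; m2eq; field.
exists c, (- (a * d - b * c) / c / c), (a / c), (m2 0 1 1 (d / c)); split=> //.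
- by rewrite !mulf_neq0 ?invr_eq0 ?oppr_eq0.
- by apply/KO_m2; rewrite mul0r mulr1 sub0r; split; auto with val.
by rewrite scalar_m2; m2eq; field.
Qed.

(** Since [A n] lies in [W], [P_notin] separates it from P (A n). It also removes the component of w
    in P (A n), which is the difference of two vectors of [W]. *)
Lemma not_free : False.
Proof.
have key n z : A n z -> W (P z) -> z = 0.
  move=> /A_good[Wz fz] WPz; apply/eqP/negPn/negP => z0.
  exact: P_notin z0 fz Wz WPz.
have [n tw] := total_all w.
have [|||||z [_ [[c ez] [z' Az' ->] ew]]] := addS_fixI1 (A := A n)
    (B := fun y => exists2 z, A n z & y = P z) (subspace_ball n) (subspace_Pball n) _ _ _ _ _ tw fw.
- by move=> g y; apply: ball_I1.
- move=> g _ Ig [x Bx ->]; have [h [Ih -> _]] := P_normalizes_I1 Ig.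
  by exists (rho h x) => //; apply: ball_I1.
- exact: ball_fixed.
- move=> _ [x Bx ->] fPx; exists x => //; apply: ball_fixed => // g Ig.
  by apply: (rho_inj P_GL); have [h [Ih _ ->]] := P_normalizes_I1 Ig; apply: fPx.
- move=> y Ay [z'' Az'' e]; suff z''0 : z'' = 0 by rewrite e z''0 (lin0 (rl P_GL)).
  by apply: (key n) => //; rewrite -e; case: (A_good Ay).
have z'0 : z' = 0.
  apply: (key n) => //; rewrite (_ : P z' = w - z); last by rewrite ew addrC addKr.
  by apply: subspaceB => //; apply: proj1; apply: (@A_good n); exists c.
move: ew; rewrite z'0 (lin0 (rl P_GL)) addr0 ez => ew.
(* Read w = sum of c_i T^(i+1) w as a relation whose coefficient at w is 1. *)
have := @free n.+2 (fun i => if i is j.+1 then - c j else 1) _ 0%N isT; move/eqP: (oner_neq0 k) => ne h.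
apply: ne; apply: h; rewrite big_ord_recl scale1r /= {1}ew -big_split big1 // => i _.
by rewrite /= -iterSr scaleNr subrr.
Qed.

End Algebraicity.

Lemma exists_hecke_eigenvector x : W x -> x != 0 ->
  exists psi y a, [/\ W y, y != 0, torus_eigen psi y & hecke y = a *: y].
Proof.
move=> Wx x0; have [x' [Wx' x'0 fx']] := exists_fixI1 Wx x0.
have WT a d y : a != 0 -> d != 0 -> W y -> W (rho (dm a d) y) by apply: WB.
have [psi [w [Ww w0 Ew]]] := exists_torus_eigen sW Wx' x'0 fx' WT.
have [[n [c [ci rel]]]|nalg] := pselect (exists n (c : nat -> k),
    (exists2 i, (i < n)%N & c i != 0) /\ \sum_(i < n) c i *: iter i hecke w = 0).
  have [|||a [y [[Wy Ey] y0 Sy]]] :=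
    eigen_of_relation (Y := fun y => W y /\ torus_eigen psi y) hecke_lin _ _ _ w0 ci rel => //.
  - by apply: subspaceI => //; apply: subspace_torus_eigen.
  - by move=> y [Wy Ey]; split; [apply: W_hecke|apply: hecke_torus_eigen].
  by exists psi, y, a.
case: (not_free Ww Ew) => n c rel i lt_i; apply/eqP/negPn/negP => ci.
by apply: nalg; exists n, c; split=> //; exists i.
Qed.

(** Only the residue 0 contributes modulo [W]: for a unit x, Pi u(x) t is upper triangular times an
    element of I1, so its term stays in [W], while Pi t = diag(1, pi) Pi. *)
Lemma P_hecke_mod y : fixI1 y -> W y -> W (P (hecke y) - rho (dm 1 pi) (P y)).
Proof.
move=> fy Wy; pose f x := if `[< vunit v x >] then 0 else rho (dm 1 pi) (P y).
have O0 : O 0 by left.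
have near0 : vge v (rep hR 0) 1.
  by have := rep_near hR O0; rewrite sub0r => /(vgeN hv); rewrite opprK.
have -> : rho (dm 1 pi) (P y) = \sum_(x <- R) f x.
  rewrite (sum_single (rep_in hR O0)) /f => [|r rR r0].
    by case: asboolP => // /vunit_not_vge1[].
  case: asboolP => // nr; case/eqP: r0; apply: (R_near_eq hR) => //; first exact: rep_in.
  by apply: (vgeB hv) => //; case: (vunitP hv (R_vge0 hR rR)).
rewrite (lin_sum _ _ _ (rl P_GL)) -sumrB; apply: subspace_sum => // x xR; rewrite /f.
case: asboolP => [ux|nx].
  have x0 := vunit_neq0 ux; have G1 : GL2 (m2 (- pi / x) 1 0 (pi * x)).
    by apply: upper_GL; rewrite ?mulf_neq0 ?invr_eq0 ?oppr_eq0.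
  have -> : P (u x (t y)) = rho (m2 (- pi / x) 1 0 (pi * x)) (rho (m2 1 0 (pi / x) 1) y).
    by rewrite rho3 // -(rhoM hrho) //; congr (rho _ y); rewrite /Pim /um /dm; m2eq; field.
  rewrite subr0 fy; first by apply: WB; rewrite ?mulf_neq0 ?invr_eq0 ?oppr_eq0.
  by apply: lower_I1; apply: (vgeMl hv); [exact: pi_vge|apply: vunit_vge0; apply: vunitV].
have px : vge v x 1 by case: (vunitP hv (R_vge0 hR xR)).
have -> : u x (t y) = t y.
  by rewrite (ut_periodic (x' := 0) fy) ?subr0 // (um0 hrho).
rewrite dm_P ?oner_eq0 // subrr; exact: subspace0.
Qed.

(** * The quotient by W as a character, and the embedding into an induced representation *)

Section Quotient.
Variables (psi : F -> F -> k) (y : V) (a : k).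
Hypothesis (Wy : W y) (y0 : y != 0) (Ey : torus_eigen psi y) (Ty : hecke y = a *: y).

Let n0 := P y.

Let n0W : ~ W n0.
Proof. by apply: P_notin => //; case: Ey. Qed.

Let eqm x x' := W (x - x').

Let eqm_refl x : eqm x x. Proof. by rewrite /eqm subrr; apply: subspace0. Qed.

Let eqm_sym x x' : eqm x x' -> eqm x' x.
Proof. by move=> h; rewrite /eqm -opprB; apply: subspaceN. Qed.

Let eqm_trans x x' x'' : eqm x x' -> eqm x' x'' -> eqm x x''.
Proof. by move=> h h'; have := subspaceD sW h h'; rewrite addrA subrK. Qed.

Let eqmZ c x x' : eqm x x' -> eqm (c *: x) (c *: x').
Proof. by move=> h; rewrite /eqm -scalerBr; apply: subspaceZ. Qed.

Let eqmB b e d x x' : b != 0 -> d != 0 -> eqm x x' -> eqm (rho (m2 b e 0 d) x) (rho (m2 b e 0 d) x').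
Proof.
by move=> b0 d0 h; rewrite /eqm -linB; [apply: WB|apply: rl; apply: upper_GL].
Qed.

Let eqm_scale_inj c c' : eqm (c *: n0) (c' *: n0) -> c = c'.
Proof.
rewrite /eqm -scalerBl => h; apply/eqP; rewrite -subr_eq0; apply/negPn/negP => cc'.
by apply: n0W; rewrite -[n0](scalerK cc'); apply: subspaceZ.
Qed.

Let eig e := exists2 c, c != 0 & eqm (rho (dm 1 e) n0) (c *: n0).

Let dm1 (e e' : F) x : e != 0 -> e' != 0 -> rho (dm 1 (e * e')) x = rho (dm 1 e) (rho (dm 1 e') x).
Proof.
move=> e0 e'0; rewrite -(rhoM hrho); [|apply: dm_GL; rewrite ?oner_eq0 // ..].
by congr (rho _ x); rewrite /dm; m2eq; ring.
Qed.

Let dm11 x : rho (dm 1 1) x = x.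
Proof. by rewrite /dm -scalar_m2 (rho1 hrho). Qed.

Let eigM e e' : e != 0 -> e' != 0 -> eig e -> eig e' -> eig (e * e').
Proof.
move=> e0 e'0 [c c0 h] [c' c'0 h']; exists (c' * c); first exact: mulf_neq0.
rewrite dm1 //; apply: (eqm_trans (x' := rho (dm 1 e) (c' *: n0))).
  by apply: eqmB; rewrite ?oner_eq0.
rewrite linZ; last by apply: rl; apply: dm_GL; rewrite ?oner_eq0.
by rewrite -scalerA; apply: eqmZ.
Qed.

Let eigV e : e != 0 -> eig e -> eig e^-1.
Proof.
move=> e0 [c c0 h]; exists c^-1; first by rewrite invr_eq0.
have eV0 : e^-1 != 0 by rewrite invr_eq0.
have E : n0 = rho (dm 1 e^-1) (rho (dm 1 e) n0) by rewrite -dm1 // mulVf // dm11.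
have el := rl (dm_GL (oner_neq0 F) eV0).
apply: eqm_sym; rewrite {1}E -[rho (dm 1 e^-1) n0](scalerK c0) -[c *: _](linZ _ _ el).
by apply: eqmZ; apply: eqmB; rewrite ?oner_eq0.
Qed.

Let tau_n0 : eqm (rho (dm 1 pi) n0) (a *: n0).
Proof.
apply: eqm_sym; rewrite /eqm -linZ; last exact: rl.
by rewrite -Ty; apply: P_hecke_mod => //; case: Ey.
Qed.

(** Otherwise diag(1, pi) n0 would lie in [W], and hence n0 too. *)
Let a0 : a != 0.
Proof.
apply/eqP => a0; apply: n0W; have := tau_n0; rewrite /eqm a0 scale0r subr0 => h.
have -> : n0 = rho (dm 1 pi^-1) (rho (dm 1 pi) n0) by rewrite -dm1 ?invr_eq0 // mulVf // dm11.
by apply: WB => //; rewrite ?oner_eq0 ?invr_eq0.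
Qed.

Let eig_all e : e != 0 -> eig e.
Proof.
have eigO e' : e' != 0 -> O e' -> eig e'.
  move=> e'0 Oe'; have [n un] := val_pi_decomp Oe' e'0.
  have pn0 i : pi ^+ i != 0 by rewrite expf_neq0.
  have -> : e' = pi ^+ n * (e' / pi ^+ n) by field.
  apply: eigM => //; first by rewrite mulf_neq0 ?invr_eq0.
    elim: n {un} => [|n IH]; first by exists 1; rewrite ?oner_eq0 // dm11 scale1r; apply: eqm_refl.
    by rewrite exprS; apply: eigM => //; exists a => //; apply: tau_n0.
  have [_ Eyy] := Ey; have u1 := vunit1 hv.
  have E : rho (dm 1 (e' / pi ^+ n)) n0 = psi (e' / pi ^+ n) 1 *: n0.
    by rewrite dm_P ?oner_eq0 ?(vunit_neq0 un) // Eyy // linZ //; apply: rl.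
  exists (psi (e' / pi ^+ n) 1); last by rewrite E; apply: eqm_refl.
  apply/eqP => z; have := rho_neq0 (dm_GL (oner_neq0 F) (vunit_neq0 un)) (rho_neq0 P_GL y0).
  by rewrite -/n0 E z scale0r eqxx.
move=> e0; have [Oe|nOe] := pselect (O e); first exact: eigO.
rewrite -[e]invrK; apply: eigV; rewrite ?invr_eq0 //; apply: eigO; rewrite ?invr_eq0 //.
right; rewrite valn_inv //; have [h|h] := leP 0 (v e); last lia.
by case: nOe; right.
Qed.

(** Conjugation by diag(1, pi^n) turns u(b) into u(b pi^n), which fixes n0 for suitable n, and
    diag(1, pi^n) acts on n0 modulo [W] by the invertible scalar a^n. *)
Let um_n0 b : eqm (u b n0) n0.
Proof.
have [fy _] := Ey; have [n On] : exists n, O (b * pi ^+ n).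
  have [->|b0] := eqVneq b 0; first by exists 0%N; rewrite mul0r; left.
  exists `|v b|%N; have pn := vgeX hv vpi `|v b|%N.
  have := vgeMD hv (or_intror (lexx (v b)) : vge v b (v b)) pn.
  by apply: vgeW; lia.
have tn i : eqm (rho (dm 1 (pi ^+ i)) n0) (a ^+ i *: n0).
  elim: i => [|i IH]; first by rewrite dm11 scale1r; apply: eqm_refl.
  rewrite !exprS dm1 ?expf_neq0 // mulrC -scalerA.
  apply: (eqm_trans (x' := rho (dm 1 pi) (a ^+ i *: n0))); first by apply: eqmB; rewrite ?oner_eq0.
  by rewrite linZ; [apply: eqmZ; apply: tau_n0|apply: rl; apply: dm_GL; rewrite ?oner_eq0].
have pn0 : pi ^+ n != 0 by rewrite expf_neq0.
have G1 : GL2 (dm 1 (pi ^+ n)) by apply: dm_GL; rewrite ?oner_eq0.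
have an0 : a ^+ n != 0 by rewrite expf_neq0.
have h : eqm (a ^+ n *: u b n0) (a ^+ n *: n0).
  apply: eqm_trans (tn n); rewrite -linZ; last by apply: rl.
  apply: eqm_trans (_ : eqm _ (u b (rho (dm 1 (pi ^+ n)) n0))) _.
    by apply: eqmB; rewrite ?oner_eq0 //; apply: eqm_sym; apply: tn.
  have -> : u b (rho (dm 1 (pi ^+ n)) n0) = rho (dm 1 (pi ^+ n)) (u (b * pi ^+ n) n0).
    rewrite -(rhoM hrho n0 (um_GL b) G1) -(rhoM hrho n0 G1 (um_GL _)).
    by congr (rho _ n0); rewrite /um /dm; m2eq; ring.
  rewrite (fix_um (P_fixI1 fy)) //; exact: eqm_refl.
by have := eqmZ (a ^+ n)^-1 h; rewrite !scalerA mulVf // !scale1r.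
Qed.

Let eig_upper b e d : b != 0 -> d != 0 ->
  exists2 c, c != 0 & eqm (rho (m2 b e 0 d) n0) (c *: n0).
Proof.
move=> b0 d0; have db0 : d / b != 0 by rewrite mulf_neq0 ?invr_eq0.
have G1 : GL2 (dm 1 (d / b)) by apply: dm_GL; rewrite ?oner_eq0.
have G2 : GL2 (b%:M : 'M_2) by rewrite scalar_m2; apply: dm_GL.
have [c c0 h] := eig_all db0; exists (omega b * c).
  rewrite mulf_neq0 //; apply/eqP => z; have := rho_neq0 G2 (rho_neq0 P_GL y0).
  by rewrite hZ // z scale0r eqxx.
have -> : rho (m2 b e 0 d) n0 = u (e / d) (rho b%:M (rho (dm 1 (d / b)) n0)).
  by rewrite rho3 //; congr (rho _ n0); rewrite scalar_m2 /um /dm; m2eq; field; rewrite ?b0 ?d0.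
rewrite hZ // linZ; last exact: rl.
rewrite -scalerA; apply: eqmZ; apply: eqm_trans (_ : eqm _ (u (e / d) (c *: n0))) _.
  by apply: eqmB; rewrite ?oner_eq0.
by rewrite linZ; [apply: eqmZ; apply: um_n0|apply: rl].
Qed.

(** By [Borel_I1_decomp] the orbit of y lies in the union of B y and B n0, hence in [W] plus the
    line of n0. *)
Let exists_coord x : exists c, eqm x (c *: n0).
Proof.
have [z [z' [Wz [c ->] ->]]] : addS W (fun z => exists c, z = c *: n0) x; last first.
  by exists c; rewrite /eqm addrK.
move: x; apply: irr_cover y0 _ => [|g Gg]; first by apply: subspace_addS => //; apply: subspace_line.
have [fy _] := Ey.
have [[b [e [c [d [b0 d0 pc ->]]]]]|[b [e [d [e' [b0 d0 Oe' ->]]]]]] := Borel_I1_decomp Gg;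
  have Gb := upper_GL e b0 d0.
  rewrite (rhoM hrho) // (fy _ (lower_I1 pc)).
  exists (rho (m2 b e 0 d) y), 0; split; rewrite ?addr0 //; first exact: WB.
  by exists 0; rewrite scale0r.
have GPe := GLM P_GL (um_GL e'); rewrite !(rhoM hrho) // (fix_um fy) //.
have [c _ h] := eig_upper e b0 d0; exists (rho (m2 b e 0 d) n0 - c *: n0), (c *: n0).
by split; rewrite ?subrK //; exists c.
Qed.

(** The coordinate on the line V / W with respect to the class of n0. *)
Let ell x := projT1 (cid (exists_coord x)).

Let ellP x : eqm x (ell x *: n0). Proof. by rewrite /ell; case: cid. Qed.

Let ell_eq x c : eqm x (c *: n0) -> ell x = c.
Proof. by move=> h; apply: eqm_scale_inj; apply: eqm_trans h; apply: eqm_sym; apply: ellP. Qed.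

Let ell_lin b x x' : ell (b *: x + x') = b * ell x + ell x'.
Proof.
apply: ell_eq; rewrite /eqm scalerDl -scalerA opprD addrACA -scalerBr.
by apply: subspaceD => //; [apply: subspaceZ => //|]; apply: ellP.
Qed.

Let ell_n0 : ell n0 = 1. Proof. by apply: ell_eq; rewrite scale1r; apply: eqm_refl. Qed.

Let chi1 b := ell (rho (dm b 1) n0).
Let chi2 d := ell (rho (dm 1 d) n0).

Let ell_upper b e d x : b != 0 -> d != 0 ->
  ell (rho (m2 b e 0 d) x) = chi1 b * chi2 d * ell x.
Proof.
move=> b0 d0; have G1 : GL2 (dm 1 d) by apply: dm_GL; rewrite ?oner_eq0.
have G2 : GL2 (dm b 1) by apply: dm_GL; rewrite ?oner_eq0.
apply: ell_eq; apply: eqm_trans (_ : eqm _ (rho (m2 b e 0 d) (ell x *: n0))) _.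
  by apply: eqmB => //; apply: ellP.
rewrite linZ; last by apply: rl; apply: upper_GL.
rewrite mulrC -scalerA; apply: eqmZ.
have -> : rho (m2 b e 0 d) n0 = rho (dm b 1) (rho (dm 1 d) (u (e / b) n0)).
  by rewrite rho3 //; congr (rho _ n0); rewrite /um /dm; m2eq; field; rewrite ?b0 ?d0.
apply: eqm_trans (_ : eqm _ (rho (dm b 1) (rho (dm 1 d) n0))) _.
  by do 2![apply: eqmB; rewrite ?oner_eq0 //]; apply: um_n0.
apply: eqm_trans (_ : eqm _ (rho (dm b 1) (chi2 d *: n0))) _.
  by apply: eqmB; rewrite ?oner_eq0 //; apply: ellP.
by rewrite linZ; [rewrite mulrC -scalerA; apply: eqmZ; apply: ellP|apply: rl].
Qed.

Let chi_smooth : smooth_char v chi1 /\ smooth_char v chi2.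
Proof.
have [n fn] := rho_smooth hrho n0.
have nz b d : b != 0 -> d != 0 -> ell (rho (dm b d) n0) != 0.
  move=> b0 d0; have [c c0 h] := eig_upper 0 b0 d0.
  by rewrite (ell_eq h).
have F10 := oner_neq0 F.
split; split=> [b b' b0 b'0|b b0|].
- rewrite -[chi1 (b * b')]/(ell _) (_ : dm (b * b') 1 = m2 b 0 0 1 *m dm b' 1); last by rewrite /dm; m2eq; ring.
  rewrite (rhoM hrho); [|exact: upper_GL..].
  rewrite ell_upper // -/(chi1 b') (_ : chi2 1 = 1) ?mulr1 //.
  by rewrite /chi2 dm11 ell_n0.
- exact: nz.
- exists n => b hb; rewrite /chi1 fn ?ell_n0 //; apply/congr_Lv/Lv_m2; rewrite subrr.
  by split=> //; left.
- rewrite -[chi2 (b * b')]/(ell _) (_ : dm 1 (b * b') = m2 1 0 0 b *m dm 1 b'); last by rewrite /dm; m2eq; ring.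
  rewrite (rhoM hrho); [|exact: upper_GL..].
  rewrite ell_upper // -/(chi2 b') (_ : chi1 1 = 1) ?mul1r //.
  by rewrite /chi1 dm11 ell_n0.
- exact: nz.
- exists n => b hb; rewrite /chi2 fn ?ell_n0 //; apply/congr_Lv/Lv_m2; rewrite subrr.
  by split=> //; left.
Qed.

(* Frobenius reciprocity: [x |-> (g |-> ell (g x))] embeds V into the induced representation. *)
Let fr (x : V) (g : 'M[F]_2) : k := if g \in unitmx then ell (rho g x) else 0.

(** A vector killed by the embedding has its whole orbit in [W]. *)
Let fr_inj x x' : (forall g, fr x g = fr x' g) -> x = x'.
Proof.
move=> e; apply/eqP; rewrite -subr_eq0; apply/negPn/negP => z0; case: Wne => z; apply; move: z.
apply: irr_cover sW z0 _ => g Gg; rewrite linB; last exact: rl.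
have := e g; rewrite /fr Gg => el; apply: eqm_trans (ellP _) _.
by rewrite el; apply: eqm_sym; apply: ellP.
Qed.

Let fr_Ind x : Ind v chi1 chi2 (fr x).
Proof.
split=> [g /negP/negPf nGg|b g Bb Gg|g Gg]; first by rewrite /fr nGg.
  have [Gb lb] := Bb; move: Gb lb Gg; rewrite (m2_eta b) !m2E /upper_tri m2E.
  move: (b _ _) (b _ _) (b _ _) (b _ _) => d c e b' Gb c0; rewrite c0 in Gb * => Gg.
  have /GL2_m2 := Gb; rewrite mulr0 subr0 mulf_eq0 => /norP[b0 d0].
  rewrite /fr (GLM Gb Gg : _ \in _) (Gg : _ \in _) (rhoM hrho) //.
  exact: ell_upper.
have [n fn] := rho_smooth hrho x; exists n => h ch.
have Gh : GL2 h by apply: KO_GL2; apply: (Lv_KO hv (ltn0Sn n)); apply/congr_Lv.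
by rewrite /fr (GLM Gg Gh : _ \in _) (Gg : _ \in _) (rhoM hrho) // fn.
Qed.

Lemma embeds_in_Ind : exists chi1 chi2,
  [/\ smooth_char v chi1, smooth_char v chi2 & subquotient_of_Ind v chi1 chi2 rho].
Proof.
have [s1 s2] := chi_smooth; exists chi1, chi2; split=> //.
have fr_lin b x x' g : fr (b *: x + x') g = b * fr x g + fr x' g.
  rewrite /fr; case: ifP => [Gg|_]; last by rewrite mulr0 addr0.
  by rewrite rl // ell_lin.
have fr0 g : fr 0 g = 0 by have := fr_lin (-1) 0 0 g; rewrite scaler0 addr0 mulN1r addNr.
have fr_rtrans h x g : GL2 h -> rtrans h (fr x) g = fr (rho h x) g.
  move=> Gh; rewrite /rtrans /fr; have -> : (g *m h \in unitmx) = (g \in unitmx).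
    by rewrite unitmx_mul (Gh : _ \in _) andbT.
  by case: ifP => // Gg; rewrite (rhoM hrho).
pose Wf f := exists x, forall g, f g = fr x g.
(* The inverse of [fr] on its image, with an arbitrary value elsewhere; it exhibits V as a quotient
   of a subspace of the induced representation. *)
have [phi phiP] : {phi : ('M[F]_2 -> k) -> V & forall f, Wf f -> forall g, f g = fr (phi f) g}.
  apply: (@choice _ _ (fun f x => Wf f -> forall g, f g = fr x g)) => f.
  by have [[x ex]|nf] := pselect (Wf f); [exists x|exists 0 => /nf].
have phiE f x : (forall g, f g = fr x g) -> phi f = x.
  by move=> e; apply: fr_inj => g; rewrite -phiP -?e //; exists x.
exists Wf, phi; split=> [f [x /funext->]| |b f h [x fx] [x' hx']|h f Gh [x fx]|].
- exact: fr_Ind.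
- by exists 0 => g; rewrite fr0.
- by exists (b *: x + x') => g; rewrite fr_lin fx hx'.
- by exists (rho h x) => g; rewrite -fr_rtrans // /rtrans fx.
split=> [b f h Wf_f Wf_h|h f Gh Wf_f|x].
- by apply: phiE => g; rewrite fr_lin -!phiP.
- by apply: phiE => g; rewrite -fr_rtrans // /rtrans -phiP.
- by exists (fr x); [exists x|apply: phiE].
Qed.

End Quotient.

End Proper.

End Main.

Theorem theorem4p3 (p : nat) (F : fieldType) (v : F -> int)
  (hF : nonarch_local_field v p)
  (k : closedFieldType) (hk : is_Fpbar p k)
  (V : lmodType k) (rho : 'M[F]_2 -> V -> V)
  (hrho : smooth_rep v rho)
  (hss : supersingular v rho) :
  irreducible_on (Borel (F:=F)) rho.
Proof.
have [hv _ [_ pres [s [sO srep]]]] := hF.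
have [_ _ [pi [pi0 vpi]]] := hv.
have [R hR] := residue_system_exists hv sO srep.
have [[Vne hirr] [omega hZ] hsub] := hss.
have [pk _] := hk.
split=> // W sW hW.
have [W0|/existsNP[x /not_implyP[Wx /eqP x0]]] := pselect (forall x, W x -> x = 0); first by left.
have [WT|/existsNP Wne] := pselect (forall x, W x); first by right.
have WB a b d y : a != 0 -> d != 0 -> W y -> W (rho (m2 a b 0 d) y).
  by move=> a0 d0; apply: hW; split; [apply: upper_GL|rewrite /upper_tri m2E].
have [psi [y [a [Wy y0 Ey Ty]]]] :=
  exists_hecke_eigenvector hv pi0 vpi hR pres pk hrho hZ hirr sW WB Wne Wx x0.
have [chi1 [chi2 [s1 s2 sub]]] := embeds_in_Ind hv pi0 vpi hR pk hrho hZ hirr sW WB Wne Wy y0 Ey Ty.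
by case: (hsub _ _ s1 s2 sub).
Qed.
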